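(* Let $0<q<1$ and let $a,b,c$ be real numbers such that $ab,ac,bc\notin\{-q^{-k}: k=1,2,\dots\}$ and $ab,ac,bc\notin[-1,0]$. Let $w(x)$ be a $q^{-1}$-Hermite weight. Then the sequence of continuous dual $q^{-1}$-Hahn polynomials $\{q_n(x;a,b,c|q)\}_{n\ge 0}$ is orthogonal with respect to the distribution $d\mu(x)=w(x;a,b,c)\,dx$, where $$w(x;a,b,c)=N(x;a,b,c)\,w(x),\qquad x=\sinh(u),$$ with $$N(x;a,b,c)=\left(-\frac{q}{a}e^{u},\frac{q}{a}e^{-u},-\frac{q}{b}e^{u},\frac{q}{b}e^{-u},-\frac{q}{c}e^{u},\frac{q}{c}e^{-u};q\right)_{\infty}.$$
   Context: The $q$-shifted factorials with base $p$ are $(\alpha;p)_0=1$, $(\alpha;p)_k=\prod_{j=0}^{k-1}(1-\alpha p^j)$ for $k=1,2,\dots$ (or $k=\infty$ when $0<p<1$), and $(\alpha_1,\dots,\alpha_i;p)_k=\prod_{j=1}^i(\alpha_j;p)_k$. For nonzero parameters $a,b,c$, the continuous dual $q^{-1}$-Hahn polynomials are the monic polynomials of degree $n$ in $x=\sinh(u)$ $$q_n(x;a,b,c|q)=\left(-\frac a2\right)^n\left(-\frac1{ab},-\frac1{ac};\frac1q\right)_n\sum_{k=0}^n\frac{\left(q^n,-\frac{e^u}{a},\frac{e^{-u}}{a};\frac1q\right)_k}{\left(-\frac1{ab},-\frac1{ac};\frac1q\right)_k}\,\frac{q^{-k}}{\left(\frac1q;\frac1q\right)_k},\qquad n=0,1,2,\dots,$$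 where the quotient $(\alpha;\frac1q)_n/(\alpha;\frac1q)_k$ is read as $\prod_{j=k}^{n-1}(1-\alpha q^{-j})$. The (monic) $q^{-1}$-Hermite polynomials $h_n$ are defined by $h_{-1}=0$, $h_0=1$, $h_{n+1}(x)=x\,h_n(x)-\frac14(q^{-n}-1)h_{n-1}(x)$. A $q^{-1}$-Hermite weight is a weight function $w\ge 0$ on $\mathbb{R}$, with finite moments of all orders, with respect to which the $q^{-1}$-Hermite polynomials are orthogonal: $\int_{-\infty}^\infty h_n h_m\,w\,dx=0$ for $m\ne n$ and $\neq 0$ for $m=n$. Orthogonality of $\{q_n\}$ with respect to $d\mu$ (which is not required to be a positive measure) means $\int_{-\infty}^{\infty}q_nq_m\,d\mu=0$ for $m\neq n$ and $\int_{-\infty}^\infty q_n^2\,d\mu\ne0$ for every $n$. *)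

(* Defs.v *)
From HB Require Import structures.
From mathcomp Require Import all_boot all_order all_algebra.
From mathcomp Require Import all_classical all_reals all_analysis.
From mathcomp Require Import ring lra.

Set Implicit Arguments.
Unset Strict Implicit.
Unset Printing Implicit Defensive.

Import Order.TTheory GRing.Theory Num.Theory.
Import numFieldNormedType.Exports.

Local Open Scope classical_set_scope.
Local Open Scope ring_scope.

Section Defs.
Context {R : realType}.
Implicit Types (q p alpha a b c u x : R) (n k : nat) (w : R -> R).

Definition qpoch alpha p k : R := \prod_(0 <= j < k) (1 - alpha * p ^+ j).

(* Meaningful when [`|p| < 1], in which case the partial products converge. *)
Definition qpoch_inf alpha p : R := limn (qpoch alpha p).

(* The quotient [qpoch alpha p n / qpoch alpha p k] for [k <= n], in the form
   that makes sense even if [qpoch alpha p k] vanishes. *)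
Definition qpoch_quot alpha p n k : R :=
  \prod_(k <= j < n) (1 - alpha * p ^+ j).

Definition sinh u : R := (expR u - expR (- u)) / 2.

Definition arsinh x : R := ln (x + Num.sqrt (x ^+ 2 + 1)).

Lemma arsinhK x : sinh (arsinh x) = x.
Proof.
have s2 : Num.sqrt (x ^+ 2 + 1) ^+ 2 = x ^+ 2 + 1.
  by rewrite sqr_sqrtr // addr_ge0 ?sqr_ge0.
have s0 : 0 <= Num.sqrt (x ^+ 2 + 1) by exact: sqrtr_ge0.
have y0 : 0 < x + Num.sqrt (x ^+ 2 + 1) by nra.
rewrite /sinh /arsinh expRN lnK ?posrE //.
have yn0 := lt0r_neq0 y0.
apply: (mulIf yn0); rewrite mulrAC mulrBl mulVf //.
by nra.
Qed.

(* Continuous dual q^-1-Hahn polynomial as a function of [u], where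
   [x = sinh u]. *)
Definition cdqHahn_u q a b c n u : R :=
  (- a / 2) ^+ n *
  \sum_(0 <= k < n.+1)
    qpoch (q ^+ n) q^-1 k * qpoch (- (expR u / a)) q^-1 k *
    qpoch (expR (- u) / a) q^-1 k *
    qpoch_quot (- (a * b)^-1) q^-1 n k * qpoch_quot (- (a * c)^-1) q^-1 n k *
    (q ^- k / qpoch q^-1 q^-1 k).

Definition cdqHahn q a b c n x : R := cdqHahn_u q a b c n (arsinh x).

Definition Nfactor_u q a b c u : R :=
  qpoch_inf (- (q / a) * expR u) q * qpoch_inf (q / a * expR (- u)) q *
  qpoch_inf (- (q / b) * expR u) q * qpoch_inf (q / b * expR (- u)) q *
  qpoch_inf (- (q / c) * expR u) q * qpoch_inf (q / c * expR (- u)) q.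

Definition Nfactor q a b c x : R := Nfactor_u q a b c (arsinh x).

(* The pair [(h_(n-1), h_n)], starting from [h_(-1) = 0] and [h_0 = 1]. *)
Fixpoint qinvHermite_pair q n : {poly R} * {poly R} :=
  if n is m.+1 then
    let: (h', h) := qinvHermite_pair q m in
    (h, 'X * h - (4^-1 * (q ^- m - 1)) *: h')
  else (0, 1).

Definition qinvHermite q n : {poly R} := (qinvHermite_pair q n).2.

Local Notation mu := (@lebesgue_measure R).

(* Orthogonality of [f] with respect to [w(x) dx], [w] possibly signed.
   Absolute convergence is required explicitly because [Rintegral] is total. *)
Definition orthogonal_wrt (f : nat -> R -> R) w : Prop :=
  (forall m n, mu.-integrable setT (EFin \o (fun x => f n x * f m x * w x))) /\
  (forall m n, m != n -> \int[mu]_(x in setT) (f n x * f m x * w x) = 0) /\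
  (forall n, \int[mu]_(x in setT) (f n x ^+ 2 * w x) <> 0).

Definition finite_moments w : Prop :=
  forall n, mu.-integrable setT (EFin \o (fun x => x ^+ n * w x)).

Definition qinvHermite_weight q w : Prop :=
  [/\ measurable_fun setT w,
      forall x, 0 <= w x,
      finite_moments w &
      orthogonal_wrt (fun n x => (qinvHermite q n).[x]) w].

End Defs.

(* Main.v *)
(** Write [h_n] for the q^-1-Hermite polynomials and [F_t(x) = (- t e^u, t e^-u; q)_oo]
    with [x = sinh u].  The functions [F_t] are the generating functions
    [sum_n q^(n (n - 1) / 2) t^n (2^n h_n(x)) / (q; q)_n], satisfy
    [F_t = (1 + 2 t x - t^2) F_(qt)], and [N = F_(q/a) F_(q/b) F_(q/c)].
    - Orthogonality alone bounds the moments of [w] by those of a log-normal law, which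
      makes products of three functions [F_t] absolutely integrable; only the moments of
      [w] matter, so the indeterminacy of the moment problem plays no role.
    - Integrating the generating series term by term, and combining the recurrence of the
      [h_n] with the q-difference equation of [F_t], one parameter at a time, gives
      [int F_r F_s F_t w = (- r s / q, - r t / q, - s t / q; q)_oo * int w].
    - Multiplication by [(- e^u / a, e^-u / a; 1/q)_k] turns [F_(q/a)] into
      [F_(q^(1-k)/a)].  Hence the integral of [q_n] against
      [(- e^u / b, e^-u / b; 1/q)_m] is a product times a terminating sum
      [sum_k (q^n; 1/q)_k / (1/q; 1/q)_k q^-k P(q^-k)] with [deg P = m], which by the
      q-binomial theorem vanishes for [m < n] and not for [m = n]. *)

Require Import Defs.
From HB Require Import structures.
From mathcomp Require Import all_boot all_order all_algebra.
From mathcomp Require Import all_classical all_reals all_analysis.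
From mathcomp Require Import measurable_realfun.
From mathcomp Require Import ring lra zify.

Set Implicit Arguments.
Unset Strict Implicit.
Unset Printing Implicit Defensive.

Import Order.TTheory GRing.Theory Num.Theory.
Import numFieldNormedType.Exports.

Local Open Scope classical_set_scope.
Local Open Scope ring_scope.

(** * Generating function *)

Section QSeries.
Context (R : realType) (q : R) (hq : 0 < q < 1).
Implicit Types (a b r s t : R) (n k M N : nat).

Let q0 : 0 < q. Proof. by case/andP: hq. Qed.
Let q1 : q < 1. Proof. by case/andP: hq. Qed.
Let qn0 : q != 0. Proof. exact: lt0r_neq0. Qed.

(* The pair [(kappa_(n-1), kappa_n)].  With [a = s + t] and [b = s t] these are the
   homogeneous Rogers-Szego polynomials in base [1/q]; [a = 2 x], [b = -1] gives [2^n h_n(x)]. *)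
Fixpoint kappa_pair a b n : R * R :=
  if n is m.+1 then
    let: (k', k) := kappa_pair a b m in (k, a * k + (q ^- m - 1) * b * k')
  else (0, 1).

Definition kappa a b n : R := (kappa_pair a b n).2.

Lemma kappa0 a b : kappa a b 0 = 1. Proof. by []. Qed.

(** At [n = 0] the coefficient [q ^- 0 - 1] vanishes, so the value of [0.-1] is harmless. *)
Lemma kappaS a b n :
  kappa a b n.+1 = a * kappa a b n + (q ^- n - 1) * b * kappa a b n.-1.
Proof.
rewrite /kappa /=; case: n => [|n] /=.
  by rewrite expr0 invr1 subrr !mul0r.
by case: kappa_pair.
Qed.

Lemma expqV_ge1 n : 1 <= q ^- n.
Proof. rewrite invf_ge1 ?exprn_gt0 //. apply: exprn_ile1; exact: ltW. Qed.

(** The coefficients [q ^- n - 1] are nonnegative, so the recurrence itself propagates the majorant.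
    Two consecutive indices are carried because it has order two. *)
Lemma norm_kappa_le a b n :
  `|kappa a b n| <= kappa `|a| `|b| n /\ `|kappa a b n.+1| <= kappa `|a| `|b| n.+1.
Proof.
elim: n => [|n [IH0 IH1]].
  by rewrite !kappaS !kappa0 expr0 invr1 subrr !mul0r !mulr1 !addr0 normr1 !lexx.
split => //; rewrite !(kappaS _ _ n.+1) /=.
have h : 0 <= q ^- n.+1 - 1 by rewrite subr_ge0 expqV_ge1.
rewrite (le_trans (ler_normD _ _))// !normrM (ger0_norm h) lerD//.
  by rewrite ler_wpM2l.
by rewrite ler_wpM2l// mulr_ge0.
Qed.

Lemma kappa_ge0 a b n : 0 <= a -> 0 <= b -> 0 <= kappa a b n.
Proof.
move=> a0 b0; have [h _] := norm_kappa_le a b n.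
by rewrite (ger0_norm a0) (ger0_norm b0) in h; exact: le_trans h.
Qed.

(* [s] and [t] are the parameters in the factorization [1 + a r + b r^2 = (1 + s r) (1 + t r)]. *)
Lemma kappa_shift s t n :
  kappa (s + t / q) (s * (t / q)) n =
  kappa (s + t) (s * t) n + (q ^- n - 1) * t * kappa (s + t) (s * t) n.-1.
Proof.
suff : (kappa (s + t / q) (s * (t / q)) n =
  kappa (s + t) (s * t) n + (q ^- n - 1) * t * kappa (s + t) (s * t) n.-1) /\
  (kappa (s + t / q) (s * (t / q)) n.+1 =
  kappa (s + t) (s * t) n.+1 + (q ^- n.+1 - 1) * t * kappa (s + t) (s * t) n).
  by case.
elim: n => [|n [IH0 IH1]].
  rewrite !kappaS !kappa0 expr0 expr1 invr1 subrr !mul0r !mulr1 !addr0.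
  by split => //; field.
split => //.
rewrite (kappaS (s + t / q)) IH1 /= IH0 (kappaS _ _ n.+1) (kappaS _ _ n) /=.
by rewrite !exprS; field; rewrite qn0 expf_neq0.
Qed.

Definition gcoef n : R := q ^+ 'C(n, 2) / qpoch q q n.

Lemma qpochS al p n : qpoch al p n.+1 = qpoch al p n * (1 - al * p ^+ n) :> R.
Proof. by rewrite /qpoch big_nat_recr. Qed.

Lemma qpoch0 al p : qpoch al p 0 = 1 :> R.
Proof. by rewrite /qpoch big_geq. Qed.

Lemma expq_lt1 n : q ^+ n.+1 < 1.
Proof. by rewrite exprn_ilt1 ?ltW. Qed.

Lemma qpochqq_gt0 n : 0 < qpoch q q n.
Proof.
elim: n => [|n IH]; first by rewrite qpoch0.
by rewrite qpochS mulr_gt0// -exprS subr_gt0 expq_lt1.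
Qed.

Lemma gcoef0 : gcoef 0 = 1.
Proof. by rewrite /gcoef qpoch0 expr0 divr1. Qed.

Lemma gcoefS n : gcoef n.+1 * (1 - q ^+ n.+1) = gcoef n * q ^+ n.
Proof.
rewrite /gcoef qpochS binS bin1 exprD -exprS.
have := lt0r_neq0 (qpochqq_gt0 n).
have : 1 - q ^+ n.+1 != 0 by rewrite subr_eq0 eq_sym lt_eqF// expq_lt1.
by move=> h1 h2; field; rewrite h1 h2.
Qed.

Lemma gcoef_gt0 n : 0 < gcoef n.
Proof. by rewrite divr_gt0 ?exprn_gt0 ?qpochqq_gt0. Qed.

Definition gser a b r M : R := \sum_(0 <= n < M) gcoef n * r ^+ n * kappa a b n.

Lemma gserS a b r M :
  gser a b r M.+1 = gser a b r M + gcoef M * r ^+ M * kappa a b M.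
Proof. by rewrite /gser big_nat_recr. Qed.

Lemma gser1 a b r : gser a b r 1 = 1.
Proof. by rewrite /gser big_nat1 gcoef0 kappa0 expr0 !mulr1. Qed.

(** Truncated form of [G(r) = (1 + a r + b r^2) G(r q)]. It is exact because the truncation order
    drops by the power of [r] in front. *)
Lemma gser_qdiff a b r M :
  gser a b r M.+2 = gser a b (r * q) M.+2 + a * r * gser a b (r * q) M.+1
    + b * r ^+ 2 * gser a b (r * q) M.
Proof.
elim: M => [|M IH].
  have h := gcoefS 0; rewrite gcoef0 expr0 mulr1 expr1 in h.
  rewrite !gserS !kappaS !kappa0 /gser !big_geq// gcoef0 !expr0 !expr1 invr1 subrr.
  have {}h : gcoef 1 = 1 + gcoef 1 * q by rewrite -h; ring.
  by rewrite [in LHS]h; ring.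
(* The terms of degree [M.+2] in [r]: after [gcoefS] this is the recurrence of [kappa]. *)
have hM : gcoef M.+2 * r ^+ M.+2 * kappa a b M.+2 =
    gcoef M.+2 * (r * q) ^+ M.+2 * kappa a b M.+2
    + a * r * (gcoef M.+1 * (r * q) ^+ M.+1 * kappa a b M.+1)
    + b * r ^+ 2 * (gcoef M * (r * q) ^+ M * kappa a b M).
  have E1 := gcoefS M.+1; have E0 := gcoefS M.
  apply: subr0_eq.
  have -> : gcoef M.+2 * r ^+ M.+2 * kappa a b M.+2 -
    (gcoef M.+2 * (r * q) ^+ M.+2 * kappa a b M.+2
    + a * r * (gcoef M.+1 * (r * q) ^+ M.+1 * kappa a b M.+1)
    + b * r ^+ 2 * (gcoef M * (r * q) ^+ M * kappa a b M)) =
    r ^+ M.+2 * (gcoef M.+2 * (1 - q ^+ M.+2) * kappa a b M.+2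
      - a * gcoef M.+1 * q ^+ M.+1 * kappa a b M.+1
      - b * (gcoef M * q ^+ M) * kappa a b M).
    by rewrite !exprMn (exprS r M.+1) (exprS r M); ring.
  rewrite E1 -E0 (kappaS _ _ M.+1) /=.
  by rewrite !exprS; field; rewrite qn0 ?expf_neq0.
rewrite (gserS _ _ r M.+2) IH hM.
rewrite (gserS _ _ (r * q) M.+2) (gserS _ _ (r * q) M.+1) (gserS _ _ (r * q) M).
by ring.
Qed.

Definition gprod a b r N : R :=
  \prod_(0 <= j < N) (1 + a * (r * q ^+ j) + b * (r * q ^+ j) ^+ 2).

Definition gprod_inf a b r : R := limn (gprod a b r).

Lemma gprodS a b r N : gprod a b r N.+1 =
  gprod a b r N * (1 + a * (r * q ^+ N) + b * (r * q ^+ N) ^+ 2).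
Proof. by rewrite /gprod big_nat_recr. Qed.

Lemma gprod0 a b r : gprod a b r 0 = 1.
Proof. by rewrite /gprod big_geq. Qed.

(** * Uniform bounds for nonnegative parameters *)

Section nonneg.
Variables (a b r : R).
Hypotheses (a0 : 0 <= a) (b0 : 0 <= b) (r0 : 0 <= r).

Lemma gser_term_ge0 s n : 0 <= s -> 0 <= gcoef n * s ^+ n * kappa a b n.
Proof.
move=> s0; rewrite mulr_ge0 ?kappa_ge0//.
by rewrite mulr_ge0 ?exprn_ge0// ltW// gcoef_gt0.
Qed.

Lemma gser_leS s M : 0 <= s -> gser a b s M <= gser a b s M.+1.
Proof. by move=> s0; rewrite gserS lerDl gser_term_ge0. Qed.

Lemma gser_ge0 s M : 0 <= s -> 0 <= gser a b s M.
Proof. by move=> s0; apply: sumr_ge0 => i _; exact: gser_term_ge0. Qed.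

Lemma gprod_ge1 s N : 0 <= s -> 1 <= gprod a b s N.
Proof.
move=> s0; elim: N => [|N IH]; first by rewrite gprod0.
rewrite gprodS (le_trans IH)// ler_peMr ?(le_trans ler01)//.
by rewrite -addrA lerDl !(addr_ge0, mulr_ge0, exprn_ge0)// ltW.
Qed.

(** Raising the lower truncation orders of [gser_qdiff] to a common [M] turns it into an inequality
    that can be iterated [N] times. *)
Lemma gser_le_gprod s M N : 0 <= s ->
  gser a b s M <= gprod a b s N * gser a b (s * q ^+ N) M.
Proof.
move=> s0; have qN0 j : 0 <= s * q ^+ j by rewrite mulr_ge0// exprn_ge0// ltW.
elim: N => [|N IH]; first by rewrite gprod0 expr0 mulr1 mul1r.
apply: (le_trans IH); rewrite gprodS -mulrA ler_wpM2l//.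
  by rewrite (le_trans ler01)// gprod_ge1.
set u := s * q ^+ N.
have -> : s * q ^+ N.+1 = u * q by rewrite exprSr mulrA.
have u0 : 0 <= u by exact: qN0.
have uq0 : 0 <= u * q by rewrite mulr_ge0// ltW.
have au : 0 <= a * u by rewrite mulr_ge0.
have bu : 0 <= b * u ^+ 2 by rewrite mulr_ge0// exprn_ge0.
case: M {IH} => [|[|M]].
- by rewrite /gser !big_geq// mulr0.
- by rewrite !gser1 mulr1 -addrA lerDl addr_ge0.
have h2 := gser_leS M.+1 uq0.
have h1 := gser_leS M uq0.
rewrite gser_qdiff !mulrDl mul1r; apply: lerD; first apply: lerD => //.
  by apply: ler_wpM2l.
by apply: ler_wpM2l => //; apply: (le_trans h1).
Qed.

(** The constant term is 1 and every other term gains at least one factor [q ^+ N]. *)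
Lemma gser_sub1_le s M N : 0 <= s ->
  gser a b (s * q ^+ N) M <= 1 + q ^+ N * gser a b s M.
Proof.
move=> s0; case: M => [|M].
  by rewrite /gser !big_geq// mulr0 addr0 ler01.
elim: M => [|M IH].
  by rewrite !gser1 lerDl mulr1 exprn_ge0// ltW.
rewrite gserS (gserS _ _ s) mulrDr addrA lerD// exprMn.
have -> : q ^+ N * (gcoef M.+1 * s ^+ M.+1 * kappa a b M.+1) =
  (gcoef M.+1 * s ^+ M.+1 * kappa a b M.+1) * q ^+ N by rewrite mulrC.
rewrite mulrA mulrAC ler_wpM2l ?gser_term_ge0//.
by rewrite -exprM ler_wiXn2l ?ltW// leq_pmulr.
Qed.


Lemma gprod_le_expR s N : 0 <= s ->
  gprod a b s N <= expR ((a * s + b * s ^+ 2) * (1 - q)^-1).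
Proof.
move=> s0; have qq : 0 < 1 - q by rewrite subr_gt0.
have ab0 : 0 <= a * s + b * s ^+ 2 by rewrite addr_ge0 ?mulr_ge0 ?exprn_ge0.
have geo : (1 - q) * \sum_(0 <= j < N) q ^+ j <= 1.
  rewrite big_mkord -opprB mulNr -subrX1 opprB lerBlDr lerDl.
  by rewrite exprn_ge0// ltW.
apply: (@le_trans _ _ (expR ((a * s + b * s ^+ 2) * \sum_(0 <= j < N) q ^+ j))).
  elim: N {geo} => [|N IH]; first by rewrite gprod0 big_geq// mulr0 expR0.
  rewrite gprodS big_nat_recr//= [in leRHS]mulrDr expRD ler_pM//.
  - by rewrite (le_trans ler01)// gprod_ge1.
  - by rewrite -addrA addr_ge0// addr_ge0 ?mulr_ge0 ?exprn_ge0 ?mulr_ge0 ?exprn_ge0// ltW.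
  rewrite (le_trans _ (expR_ge1Dx _))// -addrA lerD2l mulrDl exprMn !mulrA lerD//.
  rewrite -!mulrA ler_wpM2l// ler_wpM2l ?exprn_ge0//.
  by rewrite ler_wpM2l// ler_piMl ?exprn_ge0 ?exprn_ile1// ltW.
by rewrite ler_expR ler_wpM2l// -[leRHS]mulr1 ler_pdivlMl.
Qed.

(** Absorption: the two previous estimates give [G <= B (1 + q^N G)] for the partial sum [G]. Once
    [B q^N <= 1/2] this yields [G <= 2 B]. *)
Lemma gser_ubound s : 0 <= s -> exists B, forall M, gser a b s M <= B.
Proof.
move=> s0; set B := expR ((a * s + b * s ^+ 2) * (1 - q)^-1).
have B0 : 0 < B by exact: expR_gt0.
have [N hN] : exists N, B * q ^+ N <= 2^-1.
  have h : (fun N => B * q ^+ N) @ \oo --> B * 0.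
    by apply: cvgM; [exact: cvg_cst | apply: cvg_expr; rewrite gtr0_norm].
  rewrite mulr0 in h; have /cvgrPdist_le /(_ 2^-1) := h.
  rewrite invr_gt0 ltr0n => /(_ isT) [N _ /(_ N (leqnn N))] /=.
  rewrite sub0r normrN ger0_norm => [?|]; first by exists N.
  by rewrite mulr_ge0 ?exprn_ge0 ?ltW.
exists (B * 2) => M.
have h1 := gser_le_gprod M N s0.
have h2 := gser_sub1_le M N s0.
have h3 := gprod_le_expR N s0.
have g0 := gser_ge0 M s0.
have qN0 : 0 <= s * q ^+ N by rewrite mulr_ge0// exprn_ge0// ltW.
have h4 : gser a b s M <= B * (1 + q ^+ N * gser a b s M).
  by rewrite (le_trans h1)// ler_pM// ?gser_ge0// (le_trans ler01)// gprod_ge1.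
have h5 : B * q ^+ N * gser a b s M <= 2^-1 * gser a b s M by rewrite ler_wpM2r.
rewrite mulrDr mulr1 mulrA in h4.
set G := gser a b s M in g0 h4 h5 *; lra.
Qed.

End nonneg.

(** * Convergence of the series and of the product to the same limit *)

Lemma norm_gser_term a b r n :
  `|gcoef n * r ^+ n * kappa a b n| <= gcoef n * `|r| ^+ n * kappa `|a| `|b| n.
Proof.
have [h _] := norm_kappa_le a b n.
rewrite normrM normrM normrX (gtr0_norm (gcoef_gt0 n)) ler_wpM2l//.
by rewrite mulr_ge0 ?exprn_ge0// ltW ?gcoef_gt0.
Qed.

Lemma norm_gser_le a b r M : `|gser a b r M| <= gser `|a| `|b| `|r| M.
Proof.
by rewrite (le_trans (ler_norm_sum _ _ _))// ler_sum// => i _; exact: norm_gser_term.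
Qed.

Lemma is_cvg_gser a b r : cvgn (gser a b r).
Proof.
apply: (@normed_cvg _ _ (fun n => gcoef n * r ^+ n * kappa a b n)).
have [B hB] := gser_ubound (normr_ge0 a) (normr_ge0 b) (normr_ge0 r).
apply: nondecreasing_is_cvgn.
  by apply/nondecreasing_seqP => n; rewrite /= /series/= big_nat_recr//= lerDl.
exists B => _ [M _ <-]; rewrite /series/= (le_trans _ (hB M))//.
by apply: ler_sum => i _; exact: norm_gser_term.
Qed.

Lemma gser_qpow_sub1_le a b r M N :
  `|gser a b (r * q ^+ N) M.+1 - 1| <= q ^+ N * gser `|a| `|b| `|r| M.+1.
Proof.
elim: M => [|M IH].
  by rewrite !gser1 subrr normr0 mulr1 exprn_ge0// ltW.
rewrite gserS (gserS `|a|) mulrDr addrAC (le_trans (ler_normD _ _))// lerD//.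
rewrite (le_trans (norm_gser_term _ _ _ _))//.
rewrite normrM normrX (ger0_norm (ltW q0)) exprMn.
set T := gcoef M.+1 * `|r| ^+ M.+1 * _.
have -> : gcoef M.+1 * (`|r| ^+ M.+1 * q ^+ N ^+ M.+1) * kappa `|a| `|b| M.+1 =
  T * q ^+ N ^+ M.+1 by rewrite /T; ring.
rewrite [leRHS]mulrC ler_wpM2l ?gser_term_ge0//.
by rewrite -exprM ler_wiXn2l ?ltW// leq_pmulr.
Qed.

Lemma cvg_expqn : (fun N => q ^+ N) @ \oo --> (0 : R).
Proof. by apply: cvg_expr; rewrite gtr0_norm. Qed.

Let G a b r := limn (gser a b r).

Let G_qdiff a b r : G a b r = (1 + a * r + b * r ^+ 2) * G a b (r * q).
Proof.
apply/cvg_lim => //.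
rewrite -(cvg_shiftn 2) /=.
rewrite (_ : (fun n => _) = fun M => gser a b (r * q) (M + 2)%N +
  a * r * gser a b (r * q) (M + 1)%N + b * r ^+ 2 * gser a b (r * q) M); last first.
  by apply/funext => M; rewrite !addnS addn0 gser_qdiff.
rewrite !mulrDl mul1r; apply: cvgD; first apply: cvgD.
- by rewrite (cvg_shiftn 2 (gser a b (r * q))); exact: is_cvg_gser.
- apply: cvgM; first exact: cvg_cst.
  by rewrite (cvg_shiftn 1 (gser a b (r * q))); exact: is_cvg_gser.
- by apply: cvgM; [exact: cvg_cst | exact: is_cvg_gser].
Qed.

Let G_gprod a b r N : G a b r = gprod a b r N * G a b (r * q ^+ N).
Proof.
elim: N => [|N IH]; first by rewrite gprod0 mul1r expr0 mulr1.
by rewrite IH G_qdiff gprodS -!mulrA -exprSr.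
Qed.

Let cvg_G a b r : (fun N => G a b (r * q ^+ N)) @ \oo --> (1 : R).
Proof.
have [B hB] := gser_ubound (normr_ge0 a) (normr_ge0 b) (normr_ge0 r).
have hb N : `|G a b (r * q ^+ N) - 1| <= q ^+ N * B.
  have h : (fun M => `|gser a b (r * q ^+ N) M - 1|) @ \oo -->
      `|G a b (r * q ^+ N) - 1|.
    by apply: cvg_norm; apply: cvgB; [exact: is_cvg_gser | exact: cvg_cst].
  rewrite -(cvg_lim _ h)//; apply: limr_le; first by apply/cvg_ex; eexists; exact: h.
  exists 1%N => // -[|M] //= _; rewrite (le_trans (gser_qpow_sub1_le _ _ _ _ _))//.
  by rewrite ler_wpM2l// exprn_ge0// ltW.
apply/cvgrPdist_le => e e0.
have : (fun N => q ^+ N * B) @ \oo --> 0 * B.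
  by apply: cvgM; [exact: cvg_expqn | exact: cvg_cst].
rewrite mul0r => /cvgrPdist_le /(_ e e0); apply: filterS => N.
rewrite sub0r normrN => /ler_normlW hN.
by rewrite distrC (le_trans (hb N)).
Qed.

(** In [G(r) = gprod N * G(r q^N)] the last factor tends to 1, so the convergence of the product
    follows from that of the series. *)
Let cvg_gprodG a b r : gprod a b r N @[N --> \oo] --> G a b r.
Proof.
have h := @cvg_G a b r.
have : (fun N => G a b r / G a b (r * q ^+ N)) @ \oo --> G a b r / 1.
  by apply: cvgM; [exact: cvg_cst | apply: cvgV].
rewrite divr1; apply: cvg_trans; apply: near_eq_cvg.
have /cvgrPdist_lt /(_ 1 ltr01) := h; apply: filterS => N hN.
have hn0 : G a b (r * q ^+ N) != 0.
  by apply: contraTneq hN => ->; rewrite subr0 normr1 ltxx.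
by rewrite (G_gprod _ _ _ N) mulfK.
Qed.

Lemma cvg_gprod a b r : gprod a b r N @[N --> \oo] --> gprod_inf a b r.
Proof. by apply/cvg_ex; eexists; exact: cvg_gprodG. Qed.

Lemma cvg_gser a b r : gser a b r M @[M --> \oo] --> gprod_inf a b r.
Proof.
by rewrite /gprod_inf (cvg_lim _ (@cvg_gprodG a b r))//; exact: is_cvg_gser.
Qed.

Lemma gprod_infE a b r N : gprod_inf a b r = gprod a b r N * gprod_inf a b (r * q ^+ N).
Proof.
have E s : gprod_inf a b s = G a b s by apply/cvg_lim => //; exact: cvg_gprodG.
by rewrite !E -G_gprod.
Qed.

Lemma gprod_inf_qdiff a b r :
  gprod_inf a b r = (1 + a * r + b * r ^+ 2) * gprod_inf a b (r * q).
Proof. by rewrite (gprod_infE _ _ _ 1) gprodS gprod0 expr0 expr1 !mulr1 mul1r. Qed.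

(** A tail of the product lies within distance 1 of 1, hence is nonzero; finitely many nonzero
    factors remain. *)
Lemma gprod_inf_neq0 a b r :
  (forall j, 1 + a * (r * q ^+ j) + b * (r * q ^+ j) ^+ 2 != 0) ->
  gprod_inf a b r != 0.
Proof.
move=> h.
have E s : gprod_inf a b s = G a b s by apply/cvg_lim => //; exact: cvg_gprodG.
have /cvgrPdist_lt /(_ 1 ltr01) [N _ /(_ N (leqnn N)) /= hN] :=
  @cvg_G a b r.
rewrite (gprod_infE _ _ _ N) mulf_neq0//.
  elim: N {hN} => [|N IH]; first by rewrite gprod0 oner_neq0.
  by rewrite gprodS mulf_neq0.
by rewrite E; apply: contraTneq hN => ->; rewrite subr0 normr1 ltxx.
Qed.

(** * Identities and inequalities for the infinite product *)

Lemma gprod_inf_split s t r :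
  gprod_inf (s + t) (s * t) r = gprod_inf s 0 r * gprod_inf t 0 r.
Proof.
apply/cvg_lim => //.
rewrite (_ : gprod _ _ _ = fun N => gprod s 0 r N * gprod t 0 r N).
  by apply: cvgM; exact: cvg_gprod.
apply/funext => N; rewrite /gprod -big_split/=; apply: eq_bigr => i _; ring.
Qed.

Lemma gprod_inf_scale a b r c :
  gprod_inf a b (c * r) = gprod_inf (a * c) (b * c ^+ 2) r.
Proof.
rewrite /gprod_inf; congr (limn _); apply/funext => N.
by rewrite /gprod; apply: eq_bigr => i _; ring.
Qed.

Lemma gprod_inf00 r : gprod_inf 0 0 r = 1.
Proof.
apply/cvg_lim => //; rewrite (_ : gprod _ _ _ = fun=> 1); first exact: cvg_cst.
by apply/funext => N; rewrite /gprod big1// => i _; rewrite !mul0r !addr0.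
Qed.

Lemma gprod_inf_ge1 a b r : 0 <= a -> 0 <= b -> 0 <= r -> 1 <= gprod_inf a b r.
Proof.
move=> a0 b0 r0; apply: limr_ge; first by apply/cvg_ex; eexists; exact: cvg_gprod.
by near=> N; exact: gprod_ge1.
Unshelve. all: by end_near. Qed.

(* Factorwise, since [q^(2 j) <= q^j]. *)
Lemma gprod_inf_le a b a' r : 0 <= a -> 0 <= b -> 0 <= r -> a * r + b * r ^+ 2 <= a' ->
  gprod_inf a b r <= gprod_inf a' 0 1.
Proof.
move=> a0 b0 r0 h; apply: ler_lim; try by apply/cvg_ex; eexists; exact: cvg_gprod.
near=> N; rewrite /gprod ler_prod// => j _; rewrite mul0r addr0 mul1r.
have qj0 : 0 <= q ^+ j by rewrite exprn_ge0// ltW.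
have qj1 : q ^+ j <= 1 by rewrite exprn_ile1// ltW.
apply/andP; split.
  by rewrite !addr_ge0// mulr_ge0// ?exprn_ge0// mulr_ge0.
rewrite -addrA lerD2l.
apply: (@le_trans _ _ ((a * r + b * r ^+ 2) * q ^+ j)); last by rewrite ler_wpM2r.
rewrite mulrDl -mulrA lerD2l exprMn mulrA ler_wpM2l ?mulr_ge0 ?exprn_ge0//.
by rewrite expr2 ler_piMl.
Unshelve. all: by end_near. Qed.

Lemma norm_gser_le_gprod_inf a b r M :
  `|gser a b r M| <= gprod_inf `|a| `|b| `|r|.
Proof.
rewrite (le_trans (norm_gser_le _ _ _ _))//.
have h := @cvg_gser `|a| `|b| `|r|.
rewrite -(cvg_lim _ h)//; apply: nondecreasing_cvgn_le; last first.
  by apply/cvg_ex; eexists; exact: h.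
by apply/nondecreasing_seqP => n; exact: gser_leS.
Qed.

Lemma norm_gprod_inf_le a b r : `|gprod_inf a b r| <= gprod_inf `|a| `|b| `|r|.
Proof.
have h : (fun M => `|gser a b r M|) @ \oo --> `|gprod_inf a b r|.
  by apply: cvg_norm; exact: cvg_gser.
rewrite -(cvg_lim _ h)//; apply: limr_le; first by apply/cvg_ex; eexists; exact: h.
by near=> M; exact: norm_gser_le_gprod_inf.
Unshelve. all: by end_near. Qed.

End QSeries.

(** * Integrals of real functions *)

Section RealIntegral.
Context d (T : measurableType d) (R : realType) (mu : {measure set T -> \bar R}).
Implicit Types f g : T -> R.

Definition integ f := mu.-integrable setT (EFin \o f).

Local Notation int f := (\int[mu]_(x in setT) f x).

Lemma integ_measurable f : integ f -> measurable_fun setT f.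
Proof. by move=> /measurable_int /measurable_EFinP. Qed.

Lemma eq_integ f g : f =1 g -> integ f -> integ g.
Proof. by move=> /funext ->. Qed.

Lemma integ_le f g : measurable_fun setT f -> (forall x, `|f x| <= g x) ->
  integ g -> integ f.
Proof.
move=> mf fg; apply: le_integrable => //; first exact/measurable_EFinP.
by move=> x _; rewrite !abse_EFin lee_fin (le_trans (fg x))// ler_norm.
Qed.

Lemma integD f g : integ f -> integ g -> integ (fun x => f x + g x).
Proof. by move=> fi gi; exact: (integrableD measurableT fi gi). Qed.

Lemma integZ k f : integ f -> integ (fun x => k * f x).
Proof. by move=> fi; exact: (integrableZl measurableT k fi). Qed.

Lemma integ0 : integ (fun=> 0).
Proof. exact: integrable0. Qed.

Lemma integ_sum m n (F : nat -> T -> R) : (forall i, integ (F i)) ->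
  integ (fun x => \sum_(m <= i < n) F i x).
Proof.
move=> h; rewrite /integ (_ : _ \o _ = (fun x => \sum_(m <= i < n) (F i x)%:E)%E).
  by apply: integrable_sum => // i _; exact: h.
by apply/funext => x /=; rewrite sumEFin.
Qed.

Lemma Rintegral_sum0 m n (F : nat -> T -> R) : (forall i, integ (F i)) ->
  int (fun x => \sum_(m <= i < n) F i x) = \sum_(m <= i < n) int (F i).
Proof.
move=> h; have [mn|/ltnW mn] := leqP n m.
  rewrite big_geq// -[RHS](mul0r (int (fun=> 0))) -RintegralZl//; last exact: integ0.
  by apply: eq_Rintegral => x _; rewrite big_geq// mul0r.
elim: n mn => [|n IH] mn.
  rewrite big_geq// -[RHS](mul0r (int (fun=> 0))) -RintegralZl//; last exact: integ0.
  by apply: eq_Rintegral => x _; rewrite big_geq// mul0r.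
move: mn; rewrite leq_eqVlt => /orP[/eqP <-|mn].
  rewrite big_geq// -[RHS](mul0r (int (fun=> 0))) -RintegralZl//; last exact: integ0.
  by apply: eq_Rintegral => x _; rewrite big_geq// mul0r.
rewrite big_nat_recr//= -IH// -RintegralD//; [|exact: integ_sum|exact: h].
by apply: eq_Rintegral => x _; rewrite big_nat_recr.
Qed.

Lemma Rintegral_dominated (f_ : nat -> T -> R) f g :
  (forall n, measurable_fun setT (f_ n)) ->
  (forall x, f_ n x @[n --> \oo] --> f x) -> integ g ->
  (forall n x, `|f_ n x| <= g x) ->
  int (f_ n) @[n --> \oo] --> int f.
Proof.
move=> mf_ cf ig fg.
have mf : measurable_fun setT f by apply: measurable_fun_cvg mf_ _ => x _; exact: cf.
have [||||fi _ h] := @dominated_convergence _ T R mu setT measurableT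
  (fun n => EFin \o f_ n) (EFin \o f) (EFin \o g) _ _ _ ig.
- by move=> n; exact/measurable_EFinP.
- exact/measurable_EFinP.
- by apply: aeW => x _; apply: cvg_EFin; [exact: nearW | exact: cf].
- by apply: aeW => x n _; rewrite /= lee_fin.
apply: fine_cvg; rewrite fineK //; exact: integrable_fin_num.
Qed.

(** The dominating index may depend on the point, so [|f|] is compared with the sum of all the
    [g_ n], which is integrated term by term. *)
Lemma integ_countable_bound f (g_ : nat -> T -> R) B :
  measurable_fun setT f -> (forall n x, 0 <= g_ n x) -> (forall n, integ (g_ n)) ->
  (forall x, exists n, `|f x| <= g_ n x) ->
  (forall M, \sum_(0 <= n < M) int (g_ n) <= B) -> integ f.
Proof.
move=> mf g0 gi fg hB; apply/integrableP; split; first exact/measurable_EFinP.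
have mg n : measurable_fun setT (fun x => (g_ n x)%:E).
  exact/measurable_EFinP/integ_measurable.
apply: (@le_lt_trans _ _ (\int[mu]_(x in setT) \sum_(n <oo) (g_ n x)%:E)%E).
  apply: ge0_le_integral => //.
  - by apply: measurableT_comp => //; exact/measurable_EFinP.
  - apply: (@ge0_emeasurable_sum _ _ _ setT (fun n x => (g_ n x)%:E) xpredT) => //.
    by move=> n x _ _; rewrite lee_fin.
  move=> x _; have [n hn] := fg x.
  apply: (@le_trans _ _ (\sum_(0 <= i < n.+1) (g_ i x)%:E)%E).
    rewrite big_nat_recr//= (@le_trans _ _ (g_ n x)%:E)//.
    by rewrite leeDr// sume_ge0// => i _; rewrite lee_fin.
  by apply: nneseries_lim_ge => i _ _; rewrite lee_fin.
rewrite integral_nneseries//; last by move=> n x _; rewrite lee_fin.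
apply: (@le_lt_trans _ _ B%:E); last exact: ltry.
apply: lime_le; first by apply: is_cvg_nneseries => n _ _; apply: integral_ge0 => x _; rewrite lee_fin.
near=> M; rewrite (_ : (\sum_(0 <= i < M) _)%E = (\sum_(0 <= i < M) int (g_ i))%:E).
  by rewrite lee_fin.
rewrite -sumEFin; apply: eq_bigr => i _; rewrite /Rintegral fineK//.
exact: (integrable_fin_num measurableT (gi i)).
Unshelve. all: by end_near. Qed.

End RealIntegral.

(** * Integrals of products of generating functions *)

Section HermiteGenerating.
Context (R : realType) (q : R) (hq : 0 < q < 1).
Implicit Types (r s t x y : R) (n k : nat) (W : R -> R).

Let q0 : 0 < q. Proof. by case/andP: hq. Qed.
Let q1 : q < 1. Proof. by case/andP: hq. Qed.
Let qn0 : q != 0. Proof. exact: lt0r_neq0. Qed.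

Local Notation mu := (@lebesgue_measure R).
Local Notation int f := (\int[mu]_(x in setT) f x).
Local Notation kappa := (kappa q).
Local Notation gprod_inf := (gprod_inf q).
Local Notation gcoef := (gcoef q).

Definition hermite_gen t x : R := gprod_inf (2 * x) (-1) t.
(** The q-exponential [(- y; q)_oo] of Euler. It serves as a majorant of the generating functions
    and gives the closed form of their integrals. *)
Definition qexp y : R := gprod_inf y 0 1.
Local Notation hgen := hermite_gen.

Lemma qexp_ge1 y : 0 <= y -> 1 <= qexp y.
Proof. by move=> y0; exact: gprod_inf_ge1. Qed.

Lemma qexp_le y z : 0 <= y -> y <= z -> qexp y <= qexp z.
Proof. by move=> y0 yz; apply: gprod_inf_le => //; rewrite mul0r addr0 mulr1. Qed.

Lemma qexp0 : qexp 0 = 1.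
Proof. exact: gprod_inf00. Qed.

Lemma hgen_bound t x :
  gprod_inf `|2 * x| `|-1| `|t| <= qexp ((2 * `|t| + t ^+ 2) * (1 + `|x|)).
Proof.
apply: gprod_inf_le => //; rewrite normrM normrN normr1 normr_nat real_normK ?num_real//.
have := mulr_ge0 (sqr_ge0 t) (normr_ge0 x); have := normr_ge0 t.
move=> h1 h2; rewrite !mulrDr !mulrDl; lra.
Qed.

Lemma measurable_gprod_inf d (T : measurableType d) (a b : T -> R) r :
  measurable_fun setT a -> measurable_fun setT b ->
  measurable_fun setT (fun z => gprod_inf (a z) (b z) r).
Proof.
move=> ma mb; apply: (@measurable_fun_cvg _ _ _ _ (fun N z => gprod q (a z) (b z) r N)).
  elim=> [|N IH].
    by rewrite (_ : (fun z => _) = cst 1)//; apply/funext => z; rewrite gprod0.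
  rewrite (_ : (fun z => _) = fun z => gprod q (a z) (b z) r N *
      (1 + a z * (r * q ^+ N) + b z * (r * q ^+ N) ^+ 2)).
    apply: measurable_funM => //; apply: measurable_funD; last exact: measurable_funM.
    by apply: measurable_funD => //; exact: measurable_funM.
  by apply/funext => z; rewrite gprodS.
by move=> z _; exact: cvg_gprod.
Qed.

Lemma measurable_hgen t : measurable_fun setT (hgen t).
Proof. by apply: measurable_gprod_inf => //; exact: measurable_funM. Qed.

Lemma measurable_1norm : measurable_fun setT (fun x : R => 1 + `|x|).
Proof. by apply: measurable_funD => //; exact: measurableT_comp. Qed.

Lemma measurable_majorant d y k :
  measurable_fun setT (fun x => (1 + `|x|) ^+ d * qexp (y * (1 + `|x|)) ^+ k).
Proof.
have m := measurable_1norm.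
apply: measurable_funM; apply: measurable_funX => //.
by apply: measurable_gprod_inf => //; exact: measurable_funM.
Qed.

(** The index [k] is the number of generating functions by which [W] can still be multiplied.
    Polynomial factors cost nothing since [d] is arbitrary. *)
Definition decay k W := measurable_fun setT W /\ forall d y, 0 <= y ->
  integ mu (fun x => (1 + `|x|) ^+ d * qexp (y * (1 + `|x|)) ^+ k * `|W x|).

Lemma onenorm_ge1 x : 1 <= 1 + `|x|. Proof. by rewrite lerDl. Qed.
Lemma onenorm_ge0 x : 0 <= 1 + `|x|. Proof. by rewrite addr_ge0. Qed.
Local Hint Resolve onenorm_ge1 onenorm_ge0 : core.

Lemma qexpM_ge1 y x : 0 <= y -> 1 <= qexp (y * (1 + `|x|)).
Proof. by move=> y0; rewrite qexp_ge1// mulr_ge0. Qed.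

Lemma qexpM_ge0 y x : 0 <= y -> 0 <= qexp (y * (1 + `|x|)).
Proof. by move=> y0; rewrite (le_trans ler01)// qexpM_ge1. Qed.

Lemma decay_leq j k W : (j <= k)%N -> decay k W -> decay j W.
Proof.
move=> jk [mW h]; split => // d y y0; apply: integ_le (h d y y0).
  by apply: measurable_funM; [exact: measurable_majorant | exact: measurableT_comp].
move=> x; rewrite ger0_norm; last by rewrite !mulr_ge0 ?exprn_ge0 ?qexpM_ge0.
by rewrite ler_wpM2r// ler_wpM2l ?exprn_ge0// ler_weXn2l// qexpM_ge1.
Qed.

(** The new factor is at most [qexp (c * (1 + |x|))]. With [y + c] in place of [y], one of the
    [k.+1] powers of [qexp] absorbs it. *)
Lemma decay_hgen k W t : decay k.+1 W -> decay k (fun x => hgen t x * W x).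
Proof.
move=> [mW h]; split; first by apply: measurable_funM => //; exact: measurable_hgen.
move=> d y y0; set c := 2 * `|t| + t ^+ 2.
have c0 : 0 <= c by rewrite addr_ge0 ?sqr_ge0 ?mulr_ge0.
have yc0 : 0 <= y + c by rewrite addr_ge0.
apply: integ_le (h d (y + c) yc0).
  apply: measurable_funM; first exact: measurable_majorant.
  by apply: measurableT_comp => //; apply: measurable_funM => //; exact: measurable_hgen.
move=> x; rewrite ger0_norm; last by rewrite !mulr_ge0 ?exprn_ge0 ?qexpM_ge0.
rewrite normrM mulrA ler_wpM2r// exprSr mulrA.
apply: ler_pM => //; first by rewrite mulr_ge0 ?exprn_ge0 ?qexpM_ge0.
  rewrite ler_wpM2l ?exprn_ge0// lerXn2r ?nnegrE ?qexpM_ge0//.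
  by rewrite qexp_le ?mulr_ge0// ler_wpM2r// lerDl.
rewrite (le_trans (norm_gprod_inf_le hq _ _ _))// (le_trans (hgen_bound _ _))//.
by rewrite qexp_le ?mulr_ge0// ler_wpM2r// lerDr.
Qed.

Lemma decay_mulx k W : decay k W -> decay k (fun x => x * W x).
Proof.
move=> [mW h]; split; first exact: measurable_funM.
move=> d y y0; apply: integ_le (h d.+1 y y0).
  apply: measurable_funM; first exact: measurable_majorant.
  by apply: measurableT_comp => //; exact: measurable_funM.
move=> x; rewrite ger0_norm; last by rewrite !mulr_ge0 ?exprn_ge0 ?qexpM_ge0.
rewrite normrM mulrA ler_wpM2r// exprSr -!mulrA ler_wpM2l ?exprn_ge0//.
by rewrite mulrC ler_wpM2r ?exprn_ge0 ?qexpM_ge0// lerDr.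
Qed.

Lemma decay_integ k W : decay k W -> integ mu W.
Proof.
move=> [mW h]; apply: integ_le (h 0%N 0 (lexx _)) => // x.
by rewrite expr0 mul0r qexp0 expr1n !mul1r.
Qed.

Lemma decay_poly k W (P : {poly R}) : decay k W -> integ mu (fun x => P.[x] * W x).
Proof.
elim/poly_ind: P W => [|P c IH] W hW.
  by apply: eq_integ (integ0 mu) => x; rewrite horner0 mul0r.
apply: (@eq_integ _ _ _ mu (fun x => P.[x] * (x * W x) + c * W x)).
  by move=> x; rewrite hornerMXaddC mulrDl mulrA.
apply: integD; first by apply: IH; exact: decay_mulx.
by apply: integZ; exact: decay_integ hW.
Qed.

(** * Hermite polynomials and termwise integration of their generating function *)

Lemma qinvHermiteS n : qinvHermite q n.+1 =
  'X * qinvHermite q n - (4^-1 * (q ^- n - 1)) *: qinvHermite q n.-1.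
Proof.
rewrite /qinvHermite /=; case: n => [|n] /=.
  by rewrite expr0 invr1 subrr mulr0 !scale0r.
by case: qinvHermite_pair.
Qed.

Lemma kappa_qinvHermite n x :
  kappa (2 * x) (-1) n = (2 ^+ n *: qinvHermite q n).[x].
Proof.
suff : kappa (2 * x) (-1) n = (2 ^+ n *: qinvHermite q n).[x] /\
  kappa (2 * x) (-1) n.+1 = (2 ^+ n.+1 *: qinvHermite q n.+1).[x] by case.
elim: n => [|n [IH0 IH1]].
  rewrite kappaS kappa0 qinvHermiteS /qinvHermite /=.
  rewrite !(expr0, expr1, invr1, subrr, mulr0, mul0r, scale0r, subr0, addr0, mulr1, mul1r).
  by rewrite !hornerE.
split => //; rewrite kappaS IH1 /= IH0 (qinvHermiteS n.+1) /=.
rewrite !hornerZ hornerD hornerN hornerM hornerX hornerZ !(exprS 2).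
by field; rewrite expf_neq0.
Qed.

Lemma decay_kappa k W n : decay k W ->
  integ mu (fun x => kappa (2 * x) (-1) n * W x).
Proof.
move=> hW; apply: eq_integ (decay_poly (2 ^+ n *: qinvHermite q n) hW) => x.
by rewrite kappa_qinvHermite.
Qed.

(** Dominated convergence: one factor [qexp (c * (1 + |x|))] bounds all partial sums of the
    generating series. *)
Lemma cvg_int_hgen k W t : decay k.+1 W ->
  (\sum_(0 <= n < M) gcoef n * t ^+ n * int (fun x => kappa (2 * x) (-1) n * W x))
    @[M --> \oo] --> int (fun x => hgen t x * W x).
Proof.
move=> hW; have [mW h] := decay_leq (ltn0Sn k) hW.
have ik n : integ mu (fun x => gcoef n * t ^+ n * (kappa (2 * x) (-1) n * W x)).
  by apply: integZ; exact: decay_kappa hW.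
set c := 2 * `|t| + t ^+ 2.
have c0 : 0 <= c by rewrite addr_ge0 ?sqr_ge0 ?mulr_ge0.
have -> : (fun M => \sum_(0 <= n < M) gcoef n * t ^+ n *
      int (fun x => kappa (2 * x) (-1) n * W x)) =
    fun M => int (fun x => gser q (2 * x) (-1) t M * W x).
  apply/funext => M; rewrite (_ : (fun x => gser _ _ _ _ _ * W x) = fun x =>
      \sum_(0 <= n < M) gcoef n * t ^+ n * (kappa (2 * x) (-1) n * W x)).
    rewrite Rintegral_sum0//; apply: eq_bigr => n _.
    by rewrite RintegralZl//; exact: decay_kappa hW.
  by apply/funext => x; rewrite /gser big_distrl/=; apply: eq_bigr => n _; rewrite mulrA.
apply: (Rintegral_dominated _ _ (h 0%N c c0)) => [n|x|n x].
- apply: measurable_funM => //; rewrite /gser; apply: measurable_sum => i.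
  apply: measurable_funM => //.
  rewrite (_ : (fun x => _) = fun x => (2 ^+ i *: qinvHermite q i).[x]).
    exact: measurable_poly.
  by apply/funext => x; rewrite kappa_qinvHermite.
- by apply: cvgM; [exact: cvg_gser | exact: cvg_cst].
- rewrite expr0 mul1r expr1 normrM ler_wpM2r//.
  by rewrite (le_trans (norm_gser_le_gprod_inf hq _ _ _ _))// hgen_bound.
Qed.

Lemma hgen_qdiff t x : hgen t x = (1 + 2 * x * t - t ^+ 2) * hgen (t * q) x.
Proof. by rewrite /hermite_gen gprod_inf_qdiff// mulN1r. Qed.

Lemma Rintegral_lin3 (a b c : R) (f g h : R -> R) :
  integ mu f -> integ mu g -> integ mu h ->
  int (fun x => a * f x + b * g x + c * h x) = a * int f + b * int g + c * int h.
Proof.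
move=> fi gi hi.
have ifg := integD (integZ a fi) (integZ b gi).
by rewrite RintegralD//; [rewrite RintegralD ?RintegralZl//; exact: integZ | exact: integZ].
Qed.

(* The recurrence for the [h_n] and the [q]-difference equation of their generating
   function in [t] determine [int h_n (hgen t) W] from the case [n = 0]. *)
Lemma int_kappa_hgen W s C : decay 2 W ->
  (forall t, int (fun x => hgen t x * W x) = C * gprod_inf s 0 t) ->
  forall n t, t != 0 ->
  int (fun x => kappa (2 * x) (-1) n * (hgen t x * W x)) =
    C * gprod_inf s 0 t * kappa (s + t / q) (s * (t / q)) n.
Proof.
move=> hW h0 n.
pose K n t := int (fun x => kappa (2 * x) (-1) n * (hgen t x * W x)).
pose E n t := C * gprod_inf s 0 t * kappa (s + t) (s * t) n.
have iK m t : integ mu (fun x => kappa (2 * x) (-1) m * (hgen t x * W x)).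
  by apply: decay_kappa; exact: decay_hgen hW.
have rec m t : t * K m.+1 (t * q) = K m t - (1 - t ^+ 2) * K m (t * q)
    - t * (q ^- m - 1) * K m.-1 (t * q).
  transitivity (1 * K m t + (- (1 - t ^+ 2)) * K m (t * q)
    + (- (t * (q ^- m - 1))) * K m.-1 (t * q)); last by ring.
  rewrite /K -Rintegral_lin3// -RintegralZl//; last exact: iK.
  apply: eq_Rintegral => x _; rewrite (hgen_qdiff t) kappaS; ring.
suff : (forall t, t != 0 ->
    K n t = C * gprod_inf s 0 t * kappa (s + t / q) (s * (t / q)) n) /\
  (forall t, t != 0 ->
    K n.+1 t = C * gprod_inf s 0 t * kappa (s + t / q) (s * (t / q)) n.+1) by case.
have base t : t != 0 -> K 0%N t = C * gprod_inf s 0 t * kappa (s + t / q) (s * (t / q)) 0.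
  move=> _; rewrite kappa0 mulr1 -h0; apply: eq_Rintegral => x _.
  by rewrite kappa0 mul1r.
have step m : (forall t, t != 0 ->
      K m t = C * gprod_inf s 0 t * kappa (s + t / q) (s * (t / q)) m) ->
    (forall t, t != 0 ->
      K m.-1 t = C * gprod_inf s 0 t * kappa (s + t / q) (s * (t / q)) m.-1) ->
    (forall t, t != 0 ->
      K m.+1 t = C * gprod_inf s 0 t * kappa (s + t / q) (s * (t / q)) m.+1).
  (* The relation [rec] gives the next value at [t * q], so it is used at [t = u / q]. Then
     [kappa_shift] expresses the value at [t] through the parameters [s] and [u / q]. *)
  move=> H1 H2 u un0; pose t := u / q.
  have tn0 : t != 0 by rewrite mulf_neq0// invr_eq0.
  have ut : u = t * q by rewrite /t divfK.
  apply: (mulfI tn0); rewrite {1}ut rec -ut H1// H1// H2// -/t.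
  rewrite (gprod_inf_qdiff hq s 0 t) -ut (kappa_shift hq) kappaS.
  by ring.
by elim: n => [|n [IH0 IH1]]; split => //; [exact: step | exact: step].
Qed.

(** Summing [int_kappa_hgen] against [gcoef n * r ^+ n] gives the generating series with parameters
    [s] and [t / q], which splits into two products. *)
Lemma int_hgen2 W s C : decay 2 W ->
  (forall t, int (fun x => hgen t x * W x) = C * gprod_inf s 0 t) ->
  forall r t, t != 0 ->
  int (fun x => hgen r x * (hgen t x * W x)) =
    C * gprod_inf s 0 t * (gprod_inf s 0 r * gprod_inf (t / q) 0 r).
Proof.
move=> hW h0 r t tn0.
have /cvg_lim <- // := @cvg_int_hgen 0 _ r (decay_hgen t hW).
apply/cvg_lim => //; rewrite -(gprod_inf_split hq).
rewrite (_ : (fun M => _) = fun M => C * gprod_inf s 0 t *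
    gser q (s + t / q) (s * (t / q)) r M).
  by apply: cvgM; [exact: cvg_cst | exact: cvg_gser].
apply/funext => M; rewrite /gser big_distrr/=; apply: eq_bigr => n _.
by rewrite (int_kappa_hgen hW h0)//; ring.
Qed.

Lemma int_hgen3 w C : decay 3 w ->
  (forall t, int (fun x => hgen t x * w x) = C) ->
  forall r s t, s != 0 -> t != 0 ->
  int (fun x => hgen r x * (hgen t x * (hgen s x * w x))) =
    C * (gprod_inf (s / q) 0 t * gprod_inf (s / q) 0 r * gprod_inf (t / q) 0 r).
Proof.
move=> hw h0 r s t sn0 tn0.
(* [int_hgen2] is applied twice: here to the weight [hgen s x * w x] with parameter [s / q], and
   below to [w] itself with parameter 0, which encodes a constant integral. *)
rewrite (@int_hgen2 _ (s / q) C)//; [by ring | exact: decay_hgen | move=> u].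
have h u0 : int (fun x => hgen u0 x * w x) = C * gprod_inf 0 0 u0.
  by rewrite h0 gprod_inf00 mulr1.
rewrite (int_hgen2 (decay_leq _ hw) h)// !gprod_inf00; ring.
Qed.

End HermiteGenerating.

(** * Integrability *)

Section WeightDecay.
Context (R : realType) (q : R) (hq : 0 < q < 1) (w : R -> R).
Context (hw : qinvHermite_weight q w).
Implicit Types (r s t x y : R) (n k : nat).

Let q0 : 0 < q. Proof. by case/andP: hq. Qed.
Let q1 : q < 1. Proof. by case/andP: hq. Qed.
Let qn0 : q != 0. Proof. exact: lt0r_neq0. Qed.

Local Notation mu := (@lebesgue_measure R).
Local Notation int f := (\int[mu]_(x in setT) f x).
Local Notation kappa := (kappa q).
Local Notation gprod_inf := (gprod_inf q).
Local Notation gcoef := (gcoef q).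
Local Notation qexp := (qexp q).

Let mw : measurable_fun setT w. Proof. by case: hw. Qed.
Let w0 x : 0 <= w x. Proof. by case: hw. Qed.

Lemma weight_poly_integ (P : {poly R}) : integ mu (fun x => P.[x] * w x).
Proof.
case: hw => _ _ fm _.
have h n (Q : {poly R}) : integ mu (fun x => x ^+ n * Q.[x] * w x).
  elim/poly_ind: Q n => [|Q c IH] n.
    by apply: eq_integ (integ0 mu) => x; rewrite horner0 mulr0 mul0r.
  apply: (@eq_integ _ _ _ mu (fun x => x ^+ n.+1 * Q.[x] * w x + c * (x ^+ n * w x))).
    by move=> x; rewrite hornerMXaddC exprS; ring.
  by apply: integD; [exact: IH | apply: integZ; exact: fm].
by apply: eq_integ (h 0%N P) => x; rewrite expr0 mul1r.
Qed.

Let C := int w.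

Let C0 : 0 <= C. Proof. by apply: Rintegral_ge0. Qed.

Lemma weight_mass_neq0 : int w != 0.
Proof.
case: hw => _ _ _ [_ [_ h]]; apply/eqP => E; apply: (h 0%N); rewrite -[RHS]E.
by apply: eq_Rintegral => x _; rewrite /qinvHermite /= hornerC expr1n mul1r.
Qed.

(** Orthogonality to [h_0 = 1]. *)
Lemma int_kappa_weight k : int (fun x => kappa (2 * x) (-1) k.+1 * w x) = 0.
Proof.
case: hw => _ _ _ [ih [h _]].
have := h 0%N k.+1 isT.
rewrite (@eq_Rintegral _ _ _ mu setT (fun x => (2 ^- k.+1) * (kappa (2 * x) (-1) k.+1 * w x))).
  rewrite RintegralZl//.
    by move/eqP; rewrite mulf_eq0 invr_eq0 expf_eq0/= pnatr_eq0/= => /eqP.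
  apply: eq_integ (weight_poly_integ (2 ^+ k.+1 *: qinvHermite q k.+1)) => x.
  by rewrite (kappa_qinvHermite hq).
move=> x _; rewrite (kappa_qinvHermite hq) hornerZ.
rewrite [X in _ * X * _](_ : _ = 1); last by rewrite /qinvHermite /= hornerC.
by field; rewrite expf_neq0.
Qed.

(** These mixed moments are determined by the total mass: [MS] trades a factor [2 x] for a step up
    or down in [k], and [M0S] gives the boundary values. *)
Let M n k := int (fun x => (2 * x) ^+ n * kappa (2 * x) (-1) k * w x).

Let iM n k : integ mu (fun x => (2 * x) ^+ n * kappa (2 * x) (-1) k * w x).
Proof.
apply: eq_integ (weight_poly_integ ((2%:P * 'X) ^+ n * (2 ^+ k *: qinvHermite q k))) => x.
by rewrite hornerM horner_exp hornerM hornerC hornerX (kappa_qinvHermite hq).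
Qed.

Let MS n k : M n.+1 k = M n k.+1 + (q ^- k - 1) * M n k.-1.
Proof.
rewrite /M -RintegralZl; [|by []|exact: iM].
rewrite -RintegralD//; [|exact: iM|by apply: integZ; exact: iM].
by apply: eq_Rintegral => x _; rewrite kappaS exprS; ring.
Qed.

Let M0S k : M 0%N k.+1 = 0.
Proof. by rewrite -(int_kappa_weight k); apply: eq_Rintegral => x _; rewrite expr0 mul1r. Qed.

Let M_eq0 n k : (n < k)%N -> M n k = 0.
Proof.
elim: n k => [|n IH] [|k]//.
by rewrite ltnS => nk; rewrite MS !IH ?mulr0 ?addr0// ltnS ltnW// ltnW.
Qed.

(* [M n k] is a weighted count of the lattice paths from height [k] to [0] in [n]
   steps; the heaviest one climbs to height [(n + k) / 2] and then descends. *)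
Let M_le n k h : (n + k = h.*2)%N -> M n k <= C * 2 ^+ n * q ^- 'C(h.+1, 2).
Proof.
have B0 m j : 0 <= C * 2 ^+ m * q ^- j.
  by rewrite !mulr_ge0 ?exprn_ge0// invr_ge0 exprn_ge0// ltW.
elim: n k h => [|n IH] [|k] h E.
- have -> : h = 0%N by lia.
  rewrite bin_small// expr0 invr1 !mulr1 /M /C le_eqVlt; apply/orP; left; apply/eqP.
  by apply: eq_Rintegral => x _; rewrite expr0 kappa0 !mul1r.
- by rewrite M_eq0.
- rewrite MS expr0 invr1 subrr mul0r addr0 (le_trans (IH 1%N h _))//; first by lia.
  apply: ler_wpM2r; first by rewrite invr_ge0 exprn_ge0// ltW.
  apply: ler_wpM2l => //.
  by rewrite ler_weXn2l// ler1n.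
have [kn|kn] := ltnP n.+1 k.+1; first by rewrite M_eq0.
rewrite MS; case: h E => [//|h] E.
have IH1 := IH k.+2 h.+1 ltac:(lia).
have IH2 := IH k h ltac:(lia).
have p1 : 1 <= q ^- k.+1 by exact: expqV_ge1.
(* The step down costs at most [q ^- k.+1]. Since [k <= n] forces [k <= h], this fits into the
   increment [h.+1] of the binomial exponent. *)
have h2 : (q ^- k.+1 - 1) * M n k <= C * 2 ^+ n * q ^- 'C(h.+2, 2).
  apply: (@le_trans _ _ (q ^- k.+1 * (C * 2 ^+ n * q ^- 'C(h.+1, 2)))).
    apply: (@le_trans _ _ ((q ^- k.+1 - 1) * (C * 2 ^+ n * q ^- 'C(h.+1, 2)))).
      by rewrite ler_wpM2l// subr_ge0.
    by rewrite ler_wpM2r// gerBl.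
  rewrite mulrCA ler_wpM2l ?mulr_ge0 ?exprn_ge0//.
  rewrite -invfM -exprD lef_pV2 ?posrE ?exprn_gt0//.
  apply: ler_wiXn2l; [exact: ltW | exact: ltW |].
  by rewrite (binS h.+1 1) bin1; lia.
apply: (le_trans (lerD IH1 h2)); rewrite exprS; lra.
Qed.

Lemma even_moment_le l : int (fun x => x ^+ l.*2 * w x) <= C * q ^- 'C(l.+1, 2).
Proof.
have := @M_le l.*2 0 l; rewrite addn0 => /(_ erefl).
rewrite /M (@eq_Rintegral _ _ _ mu setT (fun x => 2 ^+ l.*2 * (x ^+ l.*2 * w x))).
  rewrite RintegralZl//; last first.
    by apply: eq_integ (weight_poly_integ 'X^(l.*2)) => x; rewrite hornerXn.
  by rewrite mulrAC [leRHS]mulrC ler_pM2l// exprn_gt0.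
by move=> x _; rewrite kappa0 mulr1 exprMn mulrA.
Qed.

(** * From moment bounds to integrability of products of three generating functions *)

Lemma onenorm_le l x : (1 + `|x|) ^+ l.*2 <= 4 ^+ l * (1 + x ^+ l.*2).
Proof.
have e4 : 4 ^+ l = 2 ^+ l.*2 :> R by rewrite -mul2n exprM expr2 -natrM.
have xl : x ^+ l.*2 = `|x| ^+ l.*2 by rewrite -!mul2n !exprM real_normK ?num_real.
rewrite e4 xl; have [x1|x1] := leP `|x| 1.
  apply: (@le_trans _ _ (2 ^+ l.*2 * 1)).
    by rewrite mulr1 lerXn2r ?nnegrE ?addr_ge0//; lra.
  by rewrite ler_wpM2l ?exprn_ge0// lerDl exprn_ge0.
apply: (@le_trans _ _ (2 ^+ l.*2 * `|x| ^+ l.*2)).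
  rewrite -exprMn lerXn2r ?nnegrE ?addr_ge0 ?mulr_ge0//; lra.
by rewrite ler_wpM2l ?exprn_ge0// lerDr.
Qed.

Let iX l : integ mu (fun x => x ^+ l * w x).
Proof. by apply: eq_integ (weight_poly_integ 'X^l) => x; rewrite hornerXn. Qed.

Lemma onenorm_integ l : integ mu (fun x => (1 + `|x|) ^+ l.*2 * w x).
Proof.
apply: (@integ_le _ _ _ mu _ (fun x => 4 ^+ l * (w x + x ^+ l.*2 * w x))).
- by apply: measurable_funM => //; apply: measurable_funX; exact: measurable_1norm.
- move=> x; rewrite ger0_norm ?mulr_ge0 ?exprn_ge0 ?addr_ge0//.
  have := ler_wpM2r (w0 x) (onenorm_le l x).
  by rewrite -mulrA mulrDl mul1r.
apply: integZ; apply: integD; last exact: iX.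
by apply: eq_integ (iX 0%N) => x; rewrite expr0 mul1r.
Qed.

Lemma onenorm_moment_le l :
  int (fun x => (1 + `|x|) ^+ l.*2 * w x) <= 4 ^+ l * (2 * C * q ^- 'C(l.+1, 2)).
Proof.
have iw : integ mu w by apply: eq_integ (iX 0%N) => x; rewrite expr0 mul1r.
apply: (@le_trans _ _ (int (fun x => 4 ^+ l * (w x + x ^+ l.*2 * w x)))).
  apply: le_Rintegral => //; first exact: onenorm_integ.
    by apply: integZ; apply: integD => //; exact: iX.
  move=> x _; have := ler_wpM2r (w0 x) (onenorm_le l x).
  by rewrite -mulrA mulrDl mul1r.
rewrite RintegralZl//; last by apply: integD => //; exact: iX.
rewrite ler_wpM2l ?exprn_ge0// RintegralD//; last exact: iX.
have h1 := even_moment_le l.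
have h2 : C <= C * q ^- 'C(l.+1, 2) by rewrite ler_peMr// expqV_ge1.
rewrite -/C; lra.
Qed.

(** Take the least [n] with [y q^(2 n) <= 1]. The tail of the product is at most [qexp 1], and each
    of the first [2 n] factors satisfies [1 + y q^j <= (1 + 1/q) y q^j]. An even number of factors
    is split off so that even moments suffice. *)
Lemma qexp_le_pow y : 1 <= y -> exists n,
  qexp y <= qexp 1 * (((1 + q^-1) * y) ^+ n.*2 * q ^+ 'C(n.*2, 2)).
Proof.
move=> y1; have y0 : 0 < y by rewrite (lt_le_trans ltr01).
have ex : exists n, y * q ^+ n.*2 <= 1.
  have h : (fun n => y * q ^+ n) @ \oo --> y * 0.
    by apply: cvgM; [exact: cvg_cst | exact: cvg_expqn].
  rewrite mulr0 in h; have /cvgrPdist_le /(_ 1 ltr01) [N _ hN] := h.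
  exists N; have := hN N.*2 ltac:(rewrite /=; lia).
  by rewrite /= sub0r normrN ger0_norm// mulr_ge0 ?exprn_ge0 ?ltW.
have [n hn mn] := ex_minnP ex; exists n.
(* Minimality gives [y q^(2 n - 2) > 1], hence [y q^(2 n - 1) >= q]. *)
have hj j : (j < n.*2)%N -> q <= y * q ^+ j.
  case: n hn mn => [//|n] hn mn jn.
  have [//|yn] := leP (y * q ^+ n.*2) 1; first by move/mn; rewrite ltnn.
  have : q * 1 <= q * (y * q ^+ n.*2) by rewrite ler_wpM2l ?ltW.
  rewrite mulr1 mulrCA -exprS => /le_trans; apply.
  apply: ler_wpM2l; first exact: ltW.
  by apply: ler_wiXn2l; [exact: ltW | exact: ltW | rewrite doubleS in jn; lia].
rewrite {1}/qexp (gprod_infE hq _ _ _ n.*2) mulrC ler_pM//.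
- by rewrite (le_trans ler01)// gprod_inf_ge1// ?ltW// mul1r exprn_gt0.
- by rewrite (le_trans ler01)// gprod_ge1// ?ltW.
- by apply: gprod_inf_le; rewrite ?mul1r ?mul0r ?addr0// ?ltW// exprn_gt0.
rewrite /gprod; move: hj; move: n.*2 => m; elim: m => [|m IH] hj.
  by rewrite big_geq// !expr0 mul1r.
rewrite big_nat_recr//= (exprS _ m) binS bin1 exprD [leRHS](_ : _ =
  (((1 + q^-1) * y) ^+ m * q ^+ 'C(m, 2)) * ((1 + q^-1) * (y * q ^+ m))); last by ring.
apply: ler_pM.
- by apply: prodr_ge0 => j _; rewrite !addr_ge0 ?mulr_ge0 ?exprn_ge0 ?mulr_ge0 ?exprn_ge0// ltW.
- by rewrite !addr_ge0 ?mulr_ge0 ?exprn_ge0 ?mulr_ge0 ?exprn_ge0// ltW.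
- by apply: IH => j jm; apply: hj; exact: ltnW.
have h1 := hj m (leqnn _).
have h2 : 1 <= q^-1 * (y * q ^+ m) by rewrite ler_pdivlMl// mulr1.
by rewrite mul0r addr0 mul1r mulrDl mul1r addrC lerD2l.
Qed.

Lemma kappa_b0 a n : kappa a 0 n = a ^+ n.
Proof.
elim: n => [|n IH]; first by rewrite kappa0.
by rewrite kappaS IH mulr0 mul0r addr0 exprS.
Qed.

(** Termwise comparison with the generating series at [b = 0], [r = 1], using
    [1 / (q; q)_n >= 1]. *)
Lemma theta_sum_bounded a : 0 <= a ->
  exists B, forall N, \sum_(0 <= n < N) a ^+ n * q ^+ 'C(n, 2) <= B.
Proof.
move=> a0; have [B hB] := gser_ubound hq a0 (lexx 0) ler01.
exists B => N; apply: le_trans (hB N); rewrite /gser; apply: ler_sum => n _.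
rewrite kappa_b0 expr1n mulr1 mulrC ler_wpM2r ?exprn_ge0//.
rewrite /gcoef ler_peMr//; first by rewrite exprn_ge0// ltW.
rewrite invf_ge1 ?(qpochqq_gt0 hq)//.
elim: n => [|n IH]; first by rewrite qpoch0.
rewrite qpochS -exprS mulr_ile1//.
- by rewrite ltW// (qpochqq_gt0 hq).
- by rewrite ltW// subr_gt0 expq_lt1.
by rewrite gerBl exprn_ge0// ltW.
Qed.

(** The exponent balance behind the case of three factors: the cube of the bound in [qexp_le_pow]
    gains about [6 n^2], the moment costs about [9 n^2 / 2], and the surplus covers ['C(n, 2)] up to
    linear terms. *)
Lemma bin2_bound d n :
  ('C((d + 3 * n).+1, 2) + 'C(n, 2) <=
    3 * 'C(n.*2, 2) + ((3 * d + 5) * n + 'C(d.+1, 2)))%N.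
Proof.
have e m : ('C(m.+1, 2) * 2 = m.+1 * m)%N by rewrite mulnC -mul_bin_diag bin1.
have e' m : ('C(m, 2) * 2 + m = m * m)%N.
  by case: m => [//|m]; rewrite e; nia.
have := e (d + 3 * n)%N; have := e d; have := e' n; have := e' n.*2; nia.
Qed.

Lemma cube_pow (e k z p : R) n m :
  (e * ((k * z) ^+ n * p ^+ m)) ^+ 3 = e ^+ 3 * (k ^+ n * p ^+ m) ^+ 3 * z ^+ (n * 3).
Proof. by rewrite exprM !exprMn; ring. Qed.

(** By [qexp_le_pow] the integrand lies at each point below one of countably many even powers of
    [1 + |x|], suitably scaled; their integrals are summable by comparison with a theta series. *)
Lemma weight_decay : decay q 3 w.
Proof.
split=> // d y y0.
pose K := (1 + q^-1) * (y + 1).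
have K0 : 0 <= K by rewrite mulr_ge0 ?addr_ge0// invr_ge0 ltW.
have E0 : 0 <= qexp 1 by rewrite (le_trans ler01)// qexp_ge1.
pose c n := qexp 1 ^+ 3 * (K ^+ n.*2 * q ^+ 'C(n.*2, 2)) ^+ 3.
have c0 n : 0 <= c n by rewrite mulr_ge0 ?exprn_ge0 ?mulr_ge0 ?exprn_ge0// ltW.
pose g n x := c n * ((1 + `|x|) ^+ (d + 3 * n).*2 * w x).
have ox x : 0 <= 1 + `|x| by rewrite addr_ge0.
have qV0 : 0 <= q ^- (3 * d + 5) by rewrite invr_ge0 exprn_ge0// ltW.
(* In this ratio [K ^+ 6] comes from the cube of [K ^+ n.*2], [4 ^+ 3] from [onenorm_moment_le] at
   [d + 3 * n], and the power of [q] from [bin2_bound]. *)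
have [B hB] := @theta_sum_bounded (K ^+ 6 * 4 ^+ 3 * q ^- (3 * d + 5))
  (mulr_ge0 (mulr_ge0 (exprn_ge0 6 K0) (exprn_ge0 3 (ler0n R 4))) qV0).
pose A := qexp 1 ^+ 3 * 4 ^+ d * (2 * C) * q ^- 'C(d.+1, 2).
have A0 : 0 <= A.
  apply: mulr_ge0; last by rewrite invr_ge0 exprn_ge0// ltW.
  by rewrite mulr_ge0 ?mulr_ge0 ?exprn_ge0.
have bnd x : exists n, `|(1 + `|x|) ^+ d * qexp (y * (1 + `|x|)) ^+ 3 * `|w x| | <= g n x.
  (* Passing from [y] to [y + 1] meets the condition [1 <= y] of [qexp_le_pow]. *)
  have z1 : 1 <= (y + 1) * (1 + `|x|).
    by rewrite mulr_ege1// ?lerDl// lerDr.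
  have [n hn] := qexp_le_pow z1; exists n.
  have yx0 : 0 <= y * (1 + `|x|) by rewrite mulr_ge0.
  have e0 : 0 <= qexp (y * (1 + `|x|)) by rewrite (le_trans ler01)// qexp_ge1.
  rewrite (ger0_norm (w0 x)) ger0_norm; last first.
    by apply: mulr_ge0 => //; apply: mulr_ge0; exact: exprn_ge0.
  rewrite /g (mulrA (c n)).
  rewrite ler_wpM2r//.
  have h1 : qexp (y * (1 + `|x|)) <= qexp ((y + 1) * (1 + `|x|)).
    by rewrite qexp_le// ler_wpM2r// lerDl.
  have h2 : qexp (y * (1 + `|x|)) ^+ 3 <= c n * (1 + `|x|) ^+ (3 * n).*2.
    apply: (@le_trans _ _ ((qexp 1 * (((1 + q^-1) * ((y + 1) * (1 + `|x|))) ^+ n.*2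
        * q ^+ 'C(n.*2, 2))) ^+ 3)).
      by rewrite lerXn2r ?nnegrE//; [exact: le_trans (le_trans h1 hn) | exact: le_trans hn].
    have e3 : (n.*2 * 3 = (3 * n).*2)%N by rewrite -!muln2 mulnAC (mulnC n).
    rewrite (mulrA (1 + q^-1)) -/K cube_pow -/(c n) e3; exact: lexx.
  rewrite doubleD exprD [leRHS]mulrCA.
  apply: ler_pM => //; try exact: exprn_ge0.
  by rewrite ler_weXn2l ?lerDl// -addnn leq_addr.
apply: (@integ_countable_bound _ _ _ mu _ g (A * B)).
- by apply: measurable_funM; [exact: measurable_majorant | exact: measurableT_comp].
- by move=> n x; rewrite mulr_ge0// mulr_ge0// exprn_ge0.
- by move=> n; apply: integZ; exact: onenorm_integ.
- exact: bnd.
move=> N; apply: (@le_trans _ _ (\sum_(0 <= n < N) A *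
  ((K ^+ 6 * 4 ^+ 3 * q ^- (3 * d + 5)) ^+ n * q ^+ 'C(n, 2)))); last first.
  by rewrite -big_distrr/= ler_wpM2l.
apply: ler_sum => n _.
rewrite /g RintegralZl//; last exact: onenorm_integ.
apply: (le_trans (ler_wpM2l (c0 n) (onenorm_moment_le _))).
have p0 m : 0 < q ^+ m by rewrite exprn_gt0.
have h : q ^+ (3 * 'C(n.*2, 2)) * q ^- 'C((d + 3 * n).+1, 2) <=
    q ^- 'C(d.+1, 2) * (q ^- (3 * d + 5)) ^+ n * q ^+ 'C(n, 2).
  rewrite ler_pdivrMr// exprVn -exprM.
  rewrite [leRHS](_ : _ = q ^+ 'C(n, 2) * q ^+ 'C((d + 3 * n).+1, 2) /
    (q ^+ 'C(d.+1, 2) * q ^+ ((3 * d + 5) * n))); last by rewrite invfM; ring.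
  rewrite ler_pdivlMr ?mulr_gt0//.
  rewrite -!exprD; apply: ler_wiXn2l; [exact: ltW | exact: ltW |].
  by move: (bin2_bound d n); clear; lia.
have -> : c n * (4 ^+ (d + 3 * n) * (2 * C * q ^- 'C((d + 3 * n).+1, 2))) =
  (qexp 1 ^+ 3 * 4 ^+ d * (2 * C) * (K ^+ 6 * 4 ^+ 3) ^+ n) *
  (q ^+ (3 * 'C(n.*2, 2)) * q ^- 'C((d + 3 * n).+1, 2)).
  have -> : (K ^+ 6 * 4 ^+ 3) ^+ n = (K ^+ n.*2) ^+ 3 * 4 ^+ (3 * n).
    rewrite (exprMn _ (K ^+ 6)) -!exprM; congr (_ ^+ _ * _).
    by clear; lia.
  rewrite /c (mulnC 3%N 'C(_, 2)) (exprM q _ 3) exprD.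
  by move: (K ^+ _) (q ^+ 'C(n.*2, 2)) (q ^- _) (4 ^+ _) (4 ^+ _) => u v z k l; ring.
have -> : A * ((K ^+ 6 * 4 ^+ 3 * q ^- (3 * d + 5)) ^+ n * q ^+ 'C(n, 2)) =
  (qexp 1 ^+ 3 * 4 ^+ d * (2 * C) * (K ^+ 6 * 4 ^+ 3) ^+ n) *
  (q ^- 'C(d.+1, 2) * (q ^- (3 * d + 5)) ^+ n * q ^+ 'C(n, 2)).
  rewrite /A (exprMn _ (K ^+ 6 * 4 ^+ 3)).
  move: (_ ^+ n) ((q ^- _) ^+ n) (q ^- _) => u v z.
  by ring.
apply: ler_wpM2l => //; apply: mulr_ge0.
  by apply: mulr_ge0; apply: mulr_ge0 => //; exact: exprn_ge0.
by apply: exprn_ge0; apply: mulr_ge0; exact: exprn_ge0.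
Qed.

(** Orthogonality leaves only the term [n = 0] of the generating series. *)
Lemma int_hgen_weight t : int (fun x => hermite_gen q t x * w x) = C.
Proof.
have /cvg_lim <- // := @cvg_int_hgen _ _ hq 2 _ t weight_decay.
apply/cvg_lim => //; rewrite -(cvg_shiftn 1)/=.
rewrite (_ : (fun n => _) = fun=> C); first exact: cvg_cst.
apply/funext => N; rewrite addn1 big_nat_recl//= big1 => [|i _].
  rewrite addr0 gcoef0 expr0 !mul1r.
  by apply: eq_Rintegral => x _; rewrite kappa0 mul1r.
by rewrite int_kappa_weight mulr0.
Qed.

End WeightDecay.

(** * Orthogonality *)

Section PolynomialBases.
Context (R : idomainType).

Lemma size_prod_linear (f : nat -> {poly R}) n :
  (forall j, size (f j) = 2%N) -> size (\prod_(0 <= j < n) f j) = n.+1.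
Proof.
move=> hf; elim: n => [|n IH]; first by rewrite big_geq// size_poly1.
rewrite big_nat_recr//= size_mul -?size_poly_eq0 ?IH ?hf//.
by rewrite addnC.
Qed.

End PolynomialBases.

Lemma coef_neq0_size (R : nzRingType) (P : {poly R}) n :
  size P = n.+1 -> P`_n != 0.
Proof. by move=> sP; rewrite -[n]/(n.+1.-1) -sP -lead_coefE lead_coef_eq0 -size_poly_eq0 sP. Qed.

Lemma reduce_degree (R : fieldType) (P B : {poly R}) n :
  (size P <= n.+1)%N -> size B = n.+1 ->
  (size (P - (P`_n / B`_n) *: B)%R <= n)%N.
Proof.
move=> sP sB; apply/leq_sizeP => j; rewrite leq_eqVlt => /orP[/eqP <-|nj].
  by rewrite coefB coefZ divfK ?subrr// coef_neq0_size.
have sBj : (size B <= j)%N by rewrite sB.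
by rewrite coefB coefZ (nth_default _ (leq_trans sP nj)) (nth_default _ sBj) mulr0 subrr.
Qed.

Section QBinomial.
Context (R : realType) (q : R) (hq : 0 < q < 1).
Implicit Types (al z : R) (n k : nat).

Let q0 : 0 < q. Proof. by case/andP: hq. Qed.
Let q1 : q < 1. Proof. by case/andP: hq. Qed.
Let qn0 : q != 0. Proof. exact: lt0r_neq0. Qed.

Lemma qpoch_quotM al (p : R) n k : (k <= n)%N ->
  qpoch_quot al p n k * qpoch al p k = qpoch al p n.
Proof. by move=> kn; rewrite mulrC /qpoch (big_cat_nat _ kn). Qed.

Lemma expqVX_neq1 n : q^-1 ^+ n.+1 != 1.
Proof. by rewrite exprVn invr_eq1 lt_eqF// expq_lt1. Qed.

Lemma qpochVV_neq0 n : qpoch q^-1 q^-1 n != 0.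
Proof.
elim: n => [|n IH]; first by rewrite qpoch0 oner_neq0.
by rewrite qpochS -exprS mulf_neq0// subr_eq0 eq_sym expqVX_neq1.
Qed.

Lemma expqK n k : (k <= n)%N -> q ^+ n * q^-1 ^+ k = q ^+ (n - k).
Proof. by move=> kn; rewrite -{1}(subnK kn) exprD exprVn mulfK// expf_neq0. Qed.

(* The Gaussian binomial coefficient up to the factor [(-1)^k q^(k (k + 1) / 2)]. *)
Definition qcoef n k := qpoch (q ^+ n) q^-1 k / qpoch q^-1 q^-1 k.

Lemma qcoef0 n : qcoef n 0 = 1.
Proof. by rewrite /qcoef !qpoch0 divr1. Qed.

Lemma qcoef_gt n : qcoef n n.+1 = 0.
Proof. by rewrite /qcoef qpochS expqK// subnn expr0 subrr mulr0 mul0r. Qed.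

Lemma qpochV_shift n k :
  qpoch (q ^+ n.+1) q^-1 k.+1 = (1 - q ^+ n.+1) * qpoch (q ^+ n) q^-1 k.
Proof.
rewrite /qpoch big_nat_recl//= expr0 mulr1; congr (_ * _).
by apply: eq_bigr => i _; rewrite [q ^+ n.+1]exprSr exprS; field.
Qed.

(** The q-Pascal rule, which drives the induction in the q-binomial theorem below. *)
Lemma qcoefS n k : qcoef n.+1 k.+1 = qcoef n k.+1 - q ^+ n.+1 * qcoef n k.
Proof.
rewrite /qcoef qpochV_shift (qpochS (q ^+ n)) (qpochS q^-1) -exprS.
have h1 := qpochVV_neq0 k.
have h2 : 1 - q^-1 ^+ k.+1 != 0 by rewrite subr_eq0 eq_sym expqVX_neq1.
have E : q^-1 ^+ k.+1 * q = q^-1 ^+ k by rewrite exprSr mulfVK.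
rewrite -E exprSr; move: h2 h1; move: (q^-1 ^+ k.+1) (qpoch q^-1 q^-1 k) => u v h2 h1.
by field; rewrite h1 h2.
Qed.

Lemma qbinomial n z :
  \sum_(0 <= k < n.+1) qcoef n k * z ^+ k = \prod_(0 <= i < n) (1 - z * q ^+ i.+1).
Proof.
elim: n => [|n IH]; first by rewrite big_nat1 big_geq// qcoef0 expr0 mulr1.
rewrite [in RHS]big_nat_recr//= -IH [in LHS]big_nat_recl//= qcoef0 expr0.
rewrite (eq_bigr (fun k => qcoef n k.+1 * z ^+ k.+1 - z * q ^+ n.+1 * (qcoef n k * z ^+ k))).
  rewrite big_split/= sumrN -mulr_sumr.
  have -> : \sum_(0 <= i < n.+1) qcoef n i.+1 * z ^+ i.+1 =
      \sum_(0 <= k < n.+1) qcoef n k * z ^+ k - 1.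
    rewrite big_nat_recr//= qcoef_gt mul0r addr0 [in RHS]big_nat_recl//=.
    by rewrite qcoef0 expr0; ring.
  ring.
by move=> k _; rewrite qcoefS [z ^+ k.+1]exprS; ring.
Qed.

(** The monomial of degree [i] contributes [qbinomial] at [z = q^(-i-1)], a product with a zero
    factor when [i < n]. Only the top coefficient survives. *)
Lemma qcoef_sum_poly n (P : {poly R}) : (size P <= n.+1)%N ->
  \sum_(0 <= k < n.+1) qcoef n k * q^-1 ^+ k * P.[q^-1 ^+ k] =
  P`_n * \prod_(0 <= i < n) (1 - q^-1 ^+ n.+1 * q ^+ i.+1).
Proof.
move=> sP.
rewrite (eq_bigr (fun k => \sum_(0 <= i < n.+1) P`_i * (qcoef n k * (q^-1 ^+ i.+1) ^+ k))).
  rewrite exchange_big/= big_nat_recr//= -mulr_sumr qbinomial big1_seq ?add0r//.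
  move=> i; rewrite mem_index_iota /= => ni.
  rewrite -mulr_sumr qbinomial (bigD1_seq i) ?mem_index_iota ?iota_uniq//=.
  by rewrite exprVn mulVf ?expf_neq0// subrr mul0r mulr0.
move=> k _; rewrite (horner_coef_wide _ sP) big_mkord mulr_sumr.
apply: eq_bigr => i _; rewrite -[q^-1 ^+ i.+1 ^+ k]exprM mulSn exprD (mulnC i) exprM; ring.
Qed.

Lemma qcoef_sum_neq0 n : \prod_(0 <= i < n) (1 - q^-1 ^+ n.+1 * q ^+ i.+1) != 0.
Proof.
rewrite prodf_seq_neq0; apply/allP => i; rewrite mem_index_iota /= => ni.
have -> : n.+1 = (i.+1 + (n - i.+1).+1)%N by lia.
rewrite exprD mulrAC -exprMn mulVf// expr1n mul1r subr_eq0 eq_sym.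
exact: expqVX_neq1.
Qed.

Lemma qpoch_qn_neq0 n : qpoch (q ^+ n) q^-1 n != 0.
Proof.
rewrite prodf_seq_neq0; apply/allP => i; rewrite mem_index_iota /= => ni.
rewrite expqK; last exact: ltnW.
rewrite subr_eq0 eq_sym -[(n - i)%N]prednK ?subn_gt0//.
by rewrite lt_eqF// expq_lt1.
Qed.

End QBinomial.

Section DualHahn.
Context (R : realType) (q : R) (hq : 0 < q < 1) (w : R -> R).
Context (hw : qinvHermite_weight q w) (a b c : R).
Context (a0 : a != 0) (b0 : b != 0) (c0 : c != 0).
Implicit Types (s t u x z : R) (n k m : nat).

Let q0 : 0 < q. Proof. by case/andP: hq. Qed.
Let q1 : q < 1. Proof. by case/andP: hq. Qed.
Let qn0 : q != 0. Proof. exact: lt0r_neq0. Qed.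

Local Notation mu := (@lebesgue_measure R).
Local Notation int f := (\int[mu]_(x in setT) f x).
Local Notation hgen := (hermite_gen q).

(* [(- e^u / s, e^(- u) / s; 1/q)_k] as a polynomial in [x = sinh u]. *)
Definition phi s k : {poly R} :=
  \prod_(0 <= j < k) ((2 * (q^-1 ^+ j / s))%:P * 'X + (1 - (q^-1 ^+ j / s) ^+ 2)%:P).

Lemma phiS s k x : (phi s k.+1).[x] =
  (phi s k).[x] * (1 + 2 * x * (q^-1 ^+ k / s) - (q^-1 ^+ k / s) ^+ 2).
Proof. by rewrite /phi big_nat_recr//= hornerM hornerMXaddC hornerC; ring. Qed.

Lemma phi0 s : phi s 0 = 1.
Proof. by rewrite /phi big_geq. Qed.

Lemma size_phi s k : s != 0 -> size (phi s k) = k.+1.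
Proof.
move=> s0; apply: size_prod_linear => j.
have h : 2 * (q^-1 ^+ j / s) != 0 by rewrite !mulf_neq0 ?invr_eq0 ?expf_neq0 ?invr_eq0.
by rewrite size_MXaddC polyC_eq0 (negbTE h)/= size_polyC h.
Qed.

Lemma phi_sinh s k u : (phi s k).[sinh u] =
  qpoch (- (expR u / s)) q^-1 k * qpoch (expR (- u) / s) q^-1 k.
Proof.
elim: k => [|k IH]; first by rewrite phi0 !qpoch0 hornerC mulr1.
rewrite phiS IH !qpochS /sinh.
have E : expR u * expR (- u) = 1 by rewrite -expRD subrr expR0.
move: (expR u) (expR (- u)) E => e f E.
have -> : (q^-1 ^+ k / s) ^+ 2 = e * f * (q^-1 ^+ k / s) ^+ 2 by rewrite E mul1r.
have -> : 2 * ((e - f) / 2) = e - f by field.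
by ring.
Qed.

(** Each factor of [phi] is the factor of [hgen_qdiff] at [t = q^(-j) / s], so it undoes one step
    from [t] to [t * q]. *)
Lemma phi_hgen s k x : s != 0 ->
  (phi s k).[x] * hgen (q / s) x = hgen (q * q^-1 ^+ k / s) x.
Proof.
move=> s0; elim: k => [|k IH]; first by rewrite phi0 hornerC mul1r expr0 mulr1.
rewrite phiS mulrAC IH (hgen_qdiff hq (q * q^-1 ^+ k.+1 / s)).
rewrite (_ : q * q^-1 ^+ k.+1 / s = q^-1 ^+ k / s); last by rewrite exprS mulrA mulfV// mul1r.
by rewrite (_ : q^-1 ^+ k / s * q = q * q^-1 ^+ k / s) 1?mulrC; ring.
Qed.

Lemma gprod_inf_qexp s t : gprod_inf q s 0 t = qexp q (s * t).
Proof. by rewrite -[t in LHS]mulr1 gprod_inf_scale mul0r. Qed.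

Lemma qexp_shift z k : qexp q (q * (q^-1 ^+ k * z)) = qpoch (- z) q^-1 k * qexp q (q * z).
Proof.
elim: k => [|k IH]; first by rewrite qpoch0 expr0 !mul1r.
rewrite qpochS mulrAC -IH.
have -> : q * (q^-1 ^+ k.+1 * z) = q^-1 ^+ k * z by rewrite exprS !mulrA mulfV// mul1r.
rewrite [LHS]/qexp (gprod_inf_qdiff hq) gprod_inf_qexp mulrC.
by congr (qexp q _ * _); ring.
Qed.

(** The weight of the theorem in terms of generating functions, as [NfactorW] confirms. *)
Let W x := hgen (q / c) x * (hgen (q / b) x * (hgen (q / a) x * w x)).
Let L (P : {poly R}) := int (fun x => P.[x] * W x).

Let decayW : decay q 0 W.
Proof. by do 3 apply: decay_hgen => //; exact: weight_decay. Qed.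

Let iL P : integ mu (fun x => P.[x] * W x).
Proof. exact: decay_poly decayW. Qed.

Let LD (P Q : {poly R}) : L (P + Q) = L P + L Q.
Proof. by rewrite /L -RintegralD; [|by []|exact: iL|exact: iL];
  apply: eq_Rintegral => x _; rewrite hornerD mulrDl. Qed.

Let LZ (r : R) (P : {poly R}) : L (r *: P) = r * L P.
Proof. by rewrite /L -RintegralZl; [|by []|exact: iL];
  apply: eq_Rintegral => x _; rewrite hornerZ (mulrA r). Qed.

Let Lsum n (F : nat -> {poly R}) :
  L (\sum_(0 <= i < n) F i) = \sum_(0 <= i < n) L (F i).
Proof.
elim: n => [|n IH]; first by rewrite !big_geq// -(scale0r 0) LZ mul0r.
by rewrite !big_nat_recr//= LD IH.
Qed.

Local Notation A := (- (a * b)^-1).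
Local Notation B := (- (a * c)^-1).
Local Notation D := (- (b * c)^-1).

Let C0 := int w * (qexp q (q * (a * b)^-1) * qexp q (q * (a * c)^-1) * qexp q (q * (b * c)^-1)).

(** Once [phi a k] and [phi b m] are absorbed, [int_hgen3] applies. The two shifts meet in the pair
    [a], [b], whence the index [k + m]. *)
Lemma L_phi k m : L (phi a k * phi b m) =
  C0 * (qpoch A q^-1 (k + m) * qpoch B q^-1 k * qpoch D q^-1 m).
Proof.
have sn0 j : q^-1 ^+ j != 0 by rewrite expf_neq0// invr_eq0.
transitivity (int (fun x => hgen (q / c) x * (hgen (q * q^-1 ^+ m / b) x *
   (hgen (q * q^-1 ^+ k / a) x * w x)))).
  by apply: eq_Rintegral => x _; rewrite /W -!phi_hgen// hornerM; ring.
rewrite (int_hgen3 hq (weight_decay hq hw) (int_hgen_weight hq hw)); last 2 first.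
- by rewrite !mulf_neq0 ?invr_eq0.
- by rewrite !mulf_neq0 ?invr_eq0.
rewrite !gprod_inf_qexp /C0.
rewrite (_ : q * q^-1 ^+ k / a / q * (q * q^-1 ^+ m / b) =
  q * (q^-1 ^+ (k + m) * (a * b)^-1)); last by rewrite exprD; field; rewrite qn0 a0 b0.
rewrite (_ : q * q^-1 ^+ k / a / q * (q / c) =
  q * (q^-1 ^+ k * (a * c)^-1)); last by field; rewrite qn0 a0 c0.
rewrite (_ : q * q^-1 ^+ m / b / q * (q / c) =
  q * (q^-1 ^+ m * (b * c)^-1)); last by field; rewrite qn0 b0 c0.
by rewrite !qexp_shift; ring.
Qed.

Definition hahn_coef n k : R := (- a / 2) ^+ n * (qpoch (q ^+ n) q^-1 k *
    qpoch_quot A q^-1 n k * qpoch_quot B q^-1 n k * (q ^- k / qpoch q^-1 q^-1 k)).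

Definition hahn_poly n : {poly R} := \sum_(0 <= k < n.+1) hahn_coef n k *: phi a k.

Lemma cdqHahn_poly n x : cdqHahn q a b c n x = (hahn_poly n).[x].
Proof.
rewrite -[in RHS](arsinhK x) /cdqHahn /cdqHahn_u /hahn_poly horner_sum mulr_sumr.
apply: eq_bigr => k _; rewrite hornerZ phi_sinh /hahn_coef; ring.
Qed.

(** The last [m] factors of [qpoch A q^-1 (k + m)], as a polynomial in [q^-1 ^+ k]. *)
Let pshift m : {poly R} :=
  \prod_(0 <= j < m) ((- (A * q^-1 ^+ j))%:P * 'X + 1%:P).

Let pshift_size m : size (pshift m) = m.+1.
Proof.
apply: size_prod_linear => j.
have h : - (A * q^-1 ^+ j) != 0.
  by rewrite oppr_eq0 mulf_neq0 ?expf_neq0 ?oppr_eq0 ?invr_eq0 ?mulf_neq0.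
by rewrite size_MXaddC polyC_eq0 (negbTE h)/= size_polyC h.
Qed.

(** The symbols in [A] and [B] supplied by [L_phi] complete the quotients of [hahn_coef] to products
    independent of [k]. What is left is the q-binomial sum of [pshift m]. *)
Lemma L_hahn_phi n m : (m <= n)%N ->
  L (hahn_poly n * phi b m) =
  C0 * (- a / 2) ^+ n * (qpoch A q^-1 n * qpoch B q^-1 n * qpoch D q^-1 m) *
  ((pshift m)`_n * \prod_(0 <= i < n) (1 - q^-1 ^+ n.+1 * q ^+ i.+1)).
Proof.
move=> mn.
have sP : (size (pshift m) <= n.+1)%N by rewrite pshift_size.
rewrite -(qcoef_sum_poly hq sP) mulr_suml Lsum mulr_sumr.
rewrite big_nat [RHS]big_nat; apply: eq_bigr => k; rewrite ltnS /= => kn.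
rewrite -scalerAl LZ L_phi /hahn_coef /qcoef.
rewrite -(qpoch_quotM A _ kn) -(qpoch_quotM B _ kn).
have -> : qpoch A q^-1 (k + m) = qpoch A q^-1 k * (pshift m).[q^-1 ^+ k].
  rewrite /qpoch (big_cat_nat (n := k)) ?leq_addr//=; congr (_ * _).
  rewrite (addnC k m) -[X in \prod_(X <= _ < _) _]add0n big_addn addnK /pshift horner_prod.
  by apply: eq_bigr => j _; rewrite hornerMXaddC hornerC exprD; ring.
by rewrite exprVn; ring.
Qed.

Lemma qpochV_neq0 t n : t != 0 -> (forall k, (1 <= k)%N -> t <> - (q ^- k)) ->
  ~ (-1 <= t <= 0) -> qpoch (- t^-1) q^-1 n != 0.
Proof.
move=> t0 hk h1; rewrite prodf_seq_neq0; apply/allP => j _ /=.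
rewrite mulNr opprK -[1](mulVf t0) -mulrDr mulf_neq0 ?invr_eq0// addr_eq0 exprVn.
(* A vanishing factor means [t = - q^(-j)]: the case [j = 0] is excluded by the interval, the others
   by the hypothesis on powers. *)
case: j => [|j]; last by apply/eqP; exact: hk.
by rewrite expr0 invr1; apply/eqP => tE; apply: h1; rewrite tE lexx lerN10.
Qed.

Lemma qexp_neq0 t : t != 0 -> ~ (-1 <= t <= 0) -> qexp q (q * t^-1) != 0.
Proof.
move=> t0 h1; apply: (gprod_inf_neq0 hq) => j.
rewrite mul0r addr0 mul1r mulrAC -exprS -[1](mulfV t0) -mulrDl.
rewrite mulf_neq0 ?invr_eq0// addr_eq0; apply/eqP => tE; apply: h1.
by rewrite tE lerN2 oppr_le0 exprn_ge0 ?ltW// (expq_lt1 hq).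
Qed.

Lemma size_hahn_poly n : (size (hahn_poly n) <= n.+1)%N.
Proof.
apply/(leq_trans (size_sum _ _ _))/bigmax_leqP_seq => k.
rewrite mem_index_iota => /andP[_ kn] _.
by rewrite (leq_trans (size_scale_leq _ _))// size_phi.
Qed.

Lemma hahn_poly_coef_neq0 n : (hahn_poly n)`_n != 0.
Proof.
rewrite /hahn_poly coef_sum big_nat_recr//= big1_seq => [|k].
  rewrite add0r coefZ mulf_neq0//; last by rewrite coef_neq0_size// size_phi.
  rewrite /hahn_coef /qpoch_quot !big_geq// !mulr1.
  by rewrite !mulf_neq0 ?invr_eq0 ?expf_neq0 ?qpoch_qn_neq0 ?qpochVV_neq0 ?mulf_neq0
    ?oppr_eq0 ?invr_eq0.
rewrite mem_index_iota /= => kn.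
by rewrite coefZ nth_default ?mulr0// size_phi.
Qed.

Context (hk : forall t : R, t \in [:: a * b; a * c; b * c] ->
     forall k, (1 <= k)%N -> t <> - (q ^- k)).
Context (h1 : forall t : R, t \in [:: a * b; a * c; b * c] -> ~ (-1 <= t <= 0)).

Let tab : a * b \in [:: a * b; a * c; b * c]. Proof. by rewrite !inE eqxx. Qed.
Let tac : a * c \in [:: a * b; a * c; b * c]. Proof. by rewrite !inE eqxx orbT. Qed.
Let tbc : b * c \in [:: a * b; a * c; b * c]. Proof. by rewrite !inE eqxx !orbT. Qed.

(** Descent on the degree of [P], removing leading terms by multiples of [phi b m]. For [m < n] the
    coefficient of [pshift m] at [n] is zero. *)
Let L_hahn_lower n (P : {poly R}) : (size P <= n)%N -> L (hahn_poly n * P) = 0.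
Proof.
suff : forall m, (m <= n)%N -> forall P : {poly R}, (size P <= m)%N -> L (hahn_poly n * P) = 0.
  by apply.
elim=> [_ Q|m IH mn Q sQ].
  by rewrite leqn0 size_poly_eq0 => /eqP ->; rewrite mulr0 -(scale0r 0) LZ mul0r.
have sB := size_phi m b0.
rewrite -(subrK ((Q`_m / (phi b m)`_m) *: phi b m) Q) mulrDr LD -scalerAr LZ.
rewrite IH ?reduce_degree//; last exact: ltnW.
rewrite add0r L_hahn_phi; last exact: ltnW.
by rewrite (nth_default _ (_ : (size (pshift m) <= n)%N)) ?pshift_size// mul0r !mulr0.
Qed.

(** Modulo lower degree, one factor is a nonzero multiple of [phi b n], so [L_hahn_phi] at [m = n]
    gives the value as a product of nonzero terms. *)
Let L_hahn_sqr n : L (hahn_poly n * hahn_poly n) != 0.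
Proof.
have sB := size_phi n b0.
have sH := size_hahn_poly n.
rewrite -{2}(subrK (((hahn_poly n)`_n / (phi b n)`_n) *: phi b n) (hahn_poly n)).
rewrite mulrDr LD L_hahn_lower ?reduce_degree// add0r -scalerAr LZ L_hahn_phi//.
have hp t m : t \in [:: a * b; a * c; b * c] -> t != 0 -> qpoch (- t^-1) q^-1 m != 0.
  by move=> ht t0; apply: qpochV_neq0; [| exact: hk | exact: h1].
have he t : t \in [:: a * b; a * c; b * c] -> t != 0 -> qexp q (q * t^-1) != 0.
  by move=> ht t0; apply: qexp_neq0; [| exact: h1].
have ab0 : a * b != 0 by rewrite mulf_neq0.
have ac0 : a * c != 0 by rewrite mulf_neq0.
have bc0 : b * c != 0 by rewrite mulf_neq0.
have C0n : C0 != 0.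
  apply: mulf_neq0; first exact: weight_mass_neq0 hw.
  by apply: mulf_neq0; [apply: mulf_neq0|]; apply: he.
apply: mulf_neq0.
  by apply: mulf_neq0; [exact: hahn_poly_coef_neq0 | rewrite invr_eq0 coef_neq0_size].
apply: mulf_neq0; last first.
  by apply: mulf_neq0; [exact: coef_neq0_size | exact: qcoef_sum_neq0].
apply: mulf_neq0.
  by apply: mulf_neq0 => //; rewrite expf_neq0// mulf_neq0 ?oppr_eq0 ?invr_eq0.
by apply: mulf_neq0; [apply: mulf_neq0|]; apply: hp.
Qed.

Let qpoch_inf_gprod al : qpoch_inf al q = gprod_inf q (- al) 0 1.
Proof.
rewrite /qpoch_inf /gprod_inf; congr (limn _); apply/funext => n.
by apply: eq_bigr => j _; ring.
Qed.

(** At [x = sinh u] one has [1 + 2 x t - t^2 = (1 + t e^u) (1 - t e^(-u))]. *)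
Lemma hermite_gen_sinh s u : hgen (q / s) (sinh u) =
  qpoch_inf (- (q / s) * expR u) q * qpoch_inf (q / s * expR (- u)) q.
Proof.
rewrite !qpoch_inf_gprod -(gprod_inf_split hq) /hermite_gen -[q / s in LHS]mulr1 gprod_inf_scale.
have E : expR u * expR (- u) = 1 by rewrite -expRD subrr expR0.
rewrite /sinh; move: (expR u) (expR (- u)) E => e f E.
have -> : 2 * ((e - f) / 2) = e - f by field.
congr (gprod_inf q _ _ 1); first by ring.
by transitivity (- (e * f) * (q / s) ^+ 2); [rewrite E|]; ring.
Qed.

Let NfactorW x : Nfactor q a b c x * w x = W x.
Proof.
by rewrite /W -(arsinhK x) !hermite_gen_sinh arsinhK /Nfactor /Nfactor_u; ring.
Qed.

Lemma cdqHahn_orthogonal :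
  orthogonal_wrt (cdqHahn q a b c) (fun x => Nfactor q a b c x * w x).
Proof.
have E m n x : cdqHahn q a b c n x * cdqHahn q a b c m x * (Nfactor q a b c x * w x) =
    (hahn_poly n * hahn_poly m).[x] * W x.
  by rewrite !cdqHahn_poly NfactorW hornerM.
split; [|split].
- by move=> m n; apply: eq_integ (iL (hahn_poly n * hahn_poly m)) => x; rewrite E.
- move=> m n mn.
  have -> : int (fun x => cdqHahn q a b c n x * cdqHahn q a b c m x *
     (Nfactor q a b c x * w x)) = L (hahn_poly n * hahn_poly m).
    by apply: eq_Rintegral => x _; rewrite E.
  case: (ltngtP m n) mn => // [mn|nm] _.
    by apply: L_hahn_lower; exact: leq_trans (size_hahn_poly m) mn.
  by rewrite mulrC; apply: L_hahn_lower; exact: leq_trans (size_hahn_poly n) nm.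
- move=> n; apply/eqP.
  have -> : int (fun x => cdqHahn q a b c n x ^+ 2 * (Nfactor q a b c x * w x)) =
     L (hahn_poly n * hahn_poly n).
    by apply: eq_Rintegral => x _; rewrite expr2 E.
  exact: L_hahn_sqr.
Qed.

End DualHahn.

Theorem theorem5 (R : realType) (q a b c : R) (w : R -> R)
  (hq : 0 < q < 1)
  (hpow : forall t : R, t \in [:: a * b; a * c; b * c] ->
     forall k : nat, (1 <= k)%N -> t <> - (q ^- k))
  (hint : forall t : R, t \in [:: a * b; a * c; b * c] -> ~ (-1 <= t <= 0))
  (hw : qinvHermite_weight q w) :
  orthogonal_wrt (cdqHahn q a b c) (fun x => Nfactor q a b c x * w x).
Proof.
(* The excluded interval contains 0, which forces [a], [b] and [c] to be nonzero. *)
have n0 (t : R) : t \in [:: a * b; a * c; b * c] -> t != 0.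
  by move=> /hint h; apply/eqP => t0; apply: h; rewrite t0 lexx lerN10.
have := n0 (a * b); rewrite !inE eqxx => /(_ isT); rewrite mulf_eq0 negb_or => /andP[a0 b0].
have := n0 (a * c); rewrite !inE eqxx orbT => /(_ isT); rewrite mulf_eq0 negb_or => /andP[_ c0].
exact: cdqHahn_orthogonal.
Qed.
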